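(* (Free Construction.) Let $\mathcal{R}$ be a representable signature, $\mathsf{S}$ a representable multicategory, and $i$ a map of representable signatures from $\mathcal{R}$ to the underlying signature of $\mathsf{S}$. Then there exists a unique representable functor $i^\ast : \mathcal{F}(\mathcal{R}) \to \mathsf{S}$ such that $i^\ast(a) = i(a)$ for every type $a$ and $i^\ast([f(x_1,\dots,x_n)]) = i(f)$ for every multiarrow $f$ of $\mathcal{R}$ (i.e. $i$ factors as the underlying map of $i^\ast$ composed with the inclusion of $\mathcal{R}$ into $\mathcal{F}(\mathcal{R})$).
   Context: A representable signature consists of a set $\mathcal{A}$ of atoms and a multigraph $\mathcal{R}$ whose nodes (types) are generated by $a ::= o \in \mathcal{A} \mid (a_1 \otimes \cdots \otimes a_k)$ for $k \in \mathbb{N}$, with sets $\mathcal{R}(a_1,\dots,a_n;b)$ of multiarrows. A representable multicategory is a multicategory $\mathsf{S}$ with chosen objects $(a_1\otimes\cdots\otimes a_k)$ and morphisms $\mathsf{re}: a_1,\dots,a_k \to (a_1\otimes\cdots\otimes a_k)$ for all objects $a_1,\dots,a_k$, such that precomposition with $\mathsf{re}$ (with identities elsewhere) induces bijections $\mathsf{S}(\gamma,(a_1\otimes\cdots\otimes a_k),\delta;a) \cong \mathsf{S}(\gamma,a_1,\dots,a_k,\delta;a)$. A representable functor preserves composition, identities, chosen tensor objects and the morphisms $\mathsf{re}$ on the nose. A map of representable signatures $i$ from $\mathcal{R}$ to $\mathsf{S}$ assigns to each type $a$ an object $i(a)$ with $i((a_1\otimes\cdots\otimes a_k)) = (i(a_1)\otimes\cdots\otimes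 i(a_k))$ and to each $f\in\mathcal{R}(a_1,\dots,a_n;b)$ a morphism $i(f)\in\mathsf{S}(i(a_1),\dots,i(a_n);i(b))$. Representable terms: $s,t ::= x \mid \langle s_1,\dots,s_k\rangle \mid s[x_1^{a_1},\dots,x_k^{a_k} := t] \mid f(s_1,\dots,s_n)$; in $s[\vec{x} := t]$ the $x_i$ are bound in $s$; terms up to renaming of bound variables. Typing rules: $x:a \vdash x:a$; if $f \in \mathcal{R}(a_1,\dots,a_n;b)$ and $\gamma_i \vdash s_i : a_i$ then $\gamma_1,\dots,\gamma_n \vdash f(s_1,\dots,s_n) : b$; if $\gamma_i \vdash s_i : a_i$ then $\gamma_1,\dots,\gamma_k \vdash \langle s_1,\dots,s_k\rangle : (a_1\otimes\cdots\otimes a_k)$; if $\gamma \vdash t : (a_1 \otimes\cdots\otimes a_k)$ and $\delta, x_1:a_1,\dots,x_k:a_k, \delta' \vdash s : b$ then $\delta,\gamma,\delta' \vdash s[x_1^{a_1},\dots,x_k^{a_k} := t] : b$; combined contexts are disjoint lists of distinct variables. $\mathrm{Rep}(\mathcal{R})(a_1,\dots,a_n;a)$ = terms $s$ with $x_1:a_1,\dots,x_n:a_n \vdash s : a$. Contexts with one hole: $\mathtt{C} ::= [\cdot] \mid \langle s_1,\dots,\mathtt{C},\dots,s_k\rangle \mid \mathtt{C}[\vec{x}:=t] \mid s[\vec{x} := \mathtt{C}] \mid f(s_1,\dots,\mathtt{C},\dots,s_n)$; $\mathtt{E}$ same grammar except that $s[\vec{x} := \mathtt{E}]$ requires $\mathtt{E}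 \neq [\cdot]$; $\mathtt{L} ::= [\cdot] \mid \mathtt{L}[\vec{x} := t]$; $\mathsf{LT}$ = terms $\mathtt{L}[\langle s_1,\dots,s_k\rangle]$. $\beta$: $s[x_1,\dots,x_k := \mathtt{L}[\langle t_1,\dots,t_k\rangle]] \to_\beta \mathtt{L}[s\{t_1/x_1,\dots,t_k/x_k\}]$, closed under $\mathtt{C}$-contexts; $\eta$: $s \to_\eta \langle x_1,\dots,x_k\rangle[x_1^{a_1},\dots,x_k^{a_k} := s]$ when $s$ has type $(a_1\otimes\cdots\otimes a_k)$, $x_i$ fresh, $s\notin\mathsf{LT}$, closed under $\mathtt{E}$-contexts; $\to_{\mathsf{rep}} = \to_\beta\cup\to_\eta$. Structural equivalence $\equiv$: smallest congruence containing $\mathtt{C}[s[\vec{x}:=t]] \equiv \mathtt{C}[s][\vec{x}:=t]$ whenever $\mathtt{C}$ binds no free variable of $t$ and $\vec{x}$ do not occur free in $\mathtt{C}$. $\mathcal{F}(\mathcal{R})$ is the multicategory with the types as objects, $\mathcal{F}(\mathcal{R})(\gamma;a) = \mathrm{Rep}(\mathcal{R})(\gamma;a)/\sim$ with $\sim$ the equivalence generated by $\equiv$ and $\to_{\mathsf{rep}}$, composition by substitution $[s]\circ\langle[t_1],\dots,[t_n]\rangle = [s\{t_1/x_1,\dots,t_n/x_n\}]$, identities $[x]$; it is representable with tensor objects the tensor types and $\mathsf{re} = [\langle x_1,\dots,x_k\rangle]$.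
   Formalization: Morphisms of F(R) are classes of typing derivations rather than of named terms: in s[ := t] with no bound variables and t closed, the place where t is inserted is recorded (also in ≡), since identifying these derivations would make the claim false, e.g. for bimodules. *)

(* Defs.v *)
From HB Require Import structures.
From Stdlib Require Import Relations.
From mathcomp Require Import all_boot generic_quotient.
From mathcomp Require Import boolp.

Set Implicit Arguments.
Unset Strict Implicit.
Unset Printing Implicit Defensive.

(* Given arrows H Γ a from a list of objects to an object, an element of
   homs H Γ [:: a1; ...; an] is a family g1 : Γ1 -> a1, ..., gn : Γn -> an with
   Γ = Γ1 ++ ... ++ Γn.  The decomposition of Γ is recorded by an equation, so
   that the laws of multicategories below need no transport along the
   associativity of concatenation.  These equations are proof irrelevant. *)
Inductive homs (O : Type) (H : seq O -> O -> Type) : seq O -> seq O -> Type :=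
| hnil : homs H [::] [::]
| hcons Γ Γ1 Γ2 a A :
    Γ = Γ1 ++ Γ2 -> H Γ1 a -> homs H Γ2 A -> homs H Γ (a :: A).
Arguments hnil {O H}.
Arguments hcons {O H Γ Γ1 Γ2 a A}.

Section Homs.
Variable O : Type.
Implicit Types (H : seq O -> O -> Type) (Γ Δ A B : seq O) (a b : O).

Definition hcast H Γ Γ' A (e : Γ = Γ') (σ : homs H Γ A) : homs H Γ' A :=
  match e in _ = X return homs H X A with erefl => σ end.

Definition hcastr H Γ A A' (e : A = A') (σ : homs H Γ A) : homs H Γ A' :=
  match e in _ = X return homs H Γ X with erefl => σ end.

Definition h1 H Γ a (g : H Γ a) : homs H Γ [:: a] :=
  hcons (esym (cats0 Γ)) g hnil.

Fixpoint hids H (id : forall a, H [:: a] a) A : homs H A A :=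
  match A with
  | [::] => hnil
  | a :: A' => hcons (Γ1 := [:: a]) erefl (id a) (hids id A')
  end.

Fixpoint hcat H Γ Γ1 Γ2 A B (σ : homs H Γ1 A) :
    Γ = Γ1 ++ Γ2 -> homs H Γ2 B -> homs H Γ (A ++ B) :=
  match σ in homs _ X Y
    return Γ = X ++ Γ2 -> homs H Γ2 B -> homs H Γ (Y ++ B) with
  | hnil => fun e τ => hcast (esym e) τ
  | hcons X X1 X2 a Y e' g σ' => fun e τ =>
      hcons (etrans e (etrans (congr1 (cat^~ Γ2) e') (esym (catA X1 X2 Γ2))))
        g (hcat σ' erefl τ)
  end.

Record uncons H Γ a A := Uncons {
  uc_dom1 : seq O; uc_dom2 : seq O; uc_eq : Γ = uc_dom1 ++ uc_dom2;
  uc_head : H uc_dom1 a; uc_tail : homs H uc_dom2 A }.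

Definition huncons H Γ a A (σ : homs H Γ (a :: A)) : uncons H Γ a A :=
  match σ in homs _ X Y
    return (match Y with [::] => unit | b :: B => uncons H X b B end) with
  | hnil => tt
  | hcons _ _ _ _ _ e g σ' => Uncons e g σ'
  end.

Definition hhead H Γ a (σ : homs H Γ [:: a]) : H Γ a :=
  let: Uncons X1 X2 e g σ' := huncons σ in
  match σ' in homs _ X Y
    return Γ = X1 ++ X -> (if Y is [::] then H Γ a else unit) with
  | hnil => fun e =>
      match esym (etrans e (cats0 X1)) in _ = X return H X a with erefl => g end
  | hcons _ _ _ _ _ _ _ _ => fun=> tt
  end e.

Record splitting H Γ A B := Splitting {
  sp_dom1 : seq O; sp_dom2 : seq O; sp_eq : Γ = sp_dom1 ++ sp_dom2;
  sp_left : homs H sp_dom1 A; sp_right : homs H sp_dom2 B }.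

Fixpoint hsplit H A B Γ : homs H Γ (A ++ B) -> splitting H Γ A B :=
  match A return homs H Γ (A ++ B) -> splitting H Γ A B with
  | [::] => fun σ => Splitting (erefl ([::] ++ Γ)) hnil σ
  | a :: A' => fun σ =>
      let: Uncons X1 X2 e g σ' := @huncons H Γ a (A' ++ B) σ in
      let: Splitting Y1 Y2 e' σ1 σ2 := @hsplit H A' B X2 σ' in
      Splitting (etrans e (etrans (congr1 (cat X1) e') (catA X1 Y1 Y2)))
        (hcons erefl g σ1) σ2
  end.

Definition hnil_cast H H' Γ (σ : homs H Γ [::]) : homs H' Γ [::] :=
  match σ in homs _ X Y
    return (if Y is [::] then homs H' X [::] else unit) with
  | hnil => hnil
  | hcons _ _ _ _ _ _ _ _ => tt
  end.

(* (g_i o τ_i)_i, where τ is split along the sources of the g_i. *)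
Definition hcomp H1 H2 H3
    (comp : forall Γ a Δ, H1 Γ a -> homs H2 Δ Γ -> H3 Δ a) :=
  fix hcomp Γ A Δ (σ : homs H1 Γ A) {struct σ} : homs H2 Δ Γ -> homs H3 Δ A :=
  match σ in homs _ X Y return homs H2 Δ X -> homs H3 Δ Y with
  | hnil => fun τ => hnil_cast H3 τ
  | hcons X X1 X2 a Y e g σ' => fun τ =>
      let: Splitting Δ1 Δ2 e' τ1 τ2 := hsplit (hcastr e τ) in
      hcons e' (comp X1 a Δ1 g τ1) (hcomp X2 Y Δ2 σ' τ2)
  end.

End Homs.

Definition hmap (O O' : Type) (H : seq O -> O -> Type)
    (H' : seq O' -> O' -> Type) (f : O -> O')
    (F : forall Γ a, H Γ a -> H' (map f Γ) (f a)) :=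
  fix hmap Γ A (σ : homs H Γ A) : homs H' (map f Γ) (map f A) :=
  match σ in homs _ X Y return homs H' (map f X) (map f Y) with
  | hnil => hnil
  | hcons X X1 X2 a Y e g σ' =>
      hcons (etrans (congr1 (map f) e) (map_cat f X1 X2)) (F X1 a g)
        (hmap X2 Y σ')
  end.

Record multicategory := Multicategory {
  ob : Type;
  hom : seq ob -> ob -> Type;
  idm : forall a, hom [:: a] a;
  comp : forall Γ a Δ, hom Γ a -> homs hom Δ Γ -> hom Δ a;
  comp_id1 : forall Γ a (f : hom Γ a), comp f (hids idm Γ) = f;
  comp_1id : forall Γ a (g : hom Γ a), comp (idm a) (h1 g) = g;
  comp_assoc : forall Γ a Δ Θ (f : hom Γ a) (σ : homs hom Δ Γ)
    (τ : homs hom Θ Δ), comp (comp f σ) τ = comp f (hcomp comp σ τ) }.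

Arguments idm {m} a.
Arguments comp {m Γ a Δ}.

(* The family id, ..., id, g, id, ..., id. *)
Definition hat (O : Type) (H : seq O -> O -> Type) (id : forall a, H [:: a] a)
    (γ A δ : seq O) (a : O) (g : H A a) :
    homs H (γ ++ A ++ δ) (γ ++ a :: δ) :=
  hcat (hids id γ) erefl (hcons erefl g (hids id δ)).

Record rep_multicategory := RepMulticategory {
  mcat :> multicategory;
  ten : seq (ob mcat) -> ob mcat;
  re : forall A, hom A (ten A);
  re_bij : forall γ A δ (a : ob mcat),
    bijective (fun f : hom (γ ++ ten A :: δ) a =>
      comp f (hat (@idm mcat) γ δ (re A))) }.

Arguments ten {r} A.
Arguments re {r} A.

(* A morphism together with its source and target; used to compare morphisms
   whose sources and targets are not syntactically equal. *)
Inductive arrow (S : multicategory) :=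
  Arrow (Γ : seq (ob S)) (a : ob S) of hom Γ a.
Arguments Arrow {S Γ a}.

Record rep_functor (M N : rep_multicategory) := RepFunctor {
  fob :> ob M -> ob N;
  fhom : forall Γ a, @hom M Γ a -> @hom N (map fob Γ) (fob a);
  fhom_id : forall a : ob M, fhom (idm a) = idm (fob a);
  fhom_comp : forall Γ a Δ (f : @hom M Γ a) (σ : homs (@hom M) Δ Γ),
    fhom (comp f σ) = comp (fhom f) (hmap fhom σ);
  fob_ten : forall A : seq (ob M), fob (ten A) = ten (map fob A);
  fhom_re : forall A : seq (ob M),
    Arrow (fhom (re A)) = Arrow (re (map fob A)) }.

Inductive ty (atom : Type) :=
| Atom of atom
| Ten of seq (ty atom).

Record signature := Signature {
  atom : Type;
  marrow : seq (ty atom) -> ty atom -> Type }.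

Arguments marrow : clear implicits.

Record sig_map (R : signature) (S : rep_multicategory) := SigMap {
  iob :> ty (atom R) -> ob S;
  iob_ten : forall A, iob (Ten A) = ten (map iob A);
  imor : forall A b, marrow R A b -> @hom S (map iob A) (iob b) }.

Section CatEq.
Variable T : Type.
Implicit Types X : seq T.

Lemma widen_eq X1 X2 X3 X4 X5 :
  X1 ++ (X2 ++ X3 ++ X4) ++ X5 = (X1 ++ X2) ++ X3 ++ X4 ++ X5.
Proof. by rewrite -!catA. Qed.

Lemma left_eq X1 X2 X3 X4 : (X1 ++ X2 ++ X3) ++ X4 = X1 ++ X2 ++ X3 ++ X4.
Proof. by rewrite -!catA. Qed.

Lemma right_eq X1 X2 X3 X4 : X1 ++ X2 ++ X3 ++ X4 = (X1 ++ X2 ++ X3) ++ X4.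
Proof. by rewrite -!catA. Qed.
End CatEq.

Definition hmap1 (O : Type) (H H' : seq O -> O -> Type)
    (F : forall Γ a, H Γ a -> H' Γ a) :=
  fix hmap1 Γ A (σ : homs H Γ A) : homs H' Γ A :=
  match σ in homs _ X Y return homs H' X Y with
  | hnil => hnil
  | hcons X X1 X2 a Y e g σ' => hcons e (F X1 a g) (hmap1 X2 Y σ')
  end.

(* Terms in context, up to renaming of the free and bound variables.  Contexts
   are ordered and every variable is used exactly once, so a variable is
   determined by its position in the context and names are not needed; an
   element of tm Γ a is a derivation of Γ |- s : a, with one constructor per
   typing rule.  A named term determines its derivation except in one case: in
   s[ := t] with no bound variable and t closed, the place δ | δ' where the empty
   context of t is inserted is not visible.  It has to be recorded, since for
   t : I -> I in a monoidal category the endomorphisms of a induced by t (x) a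
   and a (x) t are different in general, so that no interpretation of named
   terms can identify the two derivations. *)
Unset Implicit Arguments.
Inductive tm (R : signature) : seq (ty (atom R)) -> ty (atom R) -> Type :=
| Var a : tm R [:: a] a
| App Γ A b : marrow R A b -> homs (tm R) Γ A -> tm R Γ b
| Tup Γ A : homs (tm R) Γ A -> tm R Γ (Ten A)
| Let Γ Θ δ γ δ' A b : Γ = δ ++ γ ++ δ' -> Θ = δ ++ A ++ δ' ->
    tm R Θ b -> tm R γ (Ten A) -> tm R Γ b.
Set Implicit Arguments.
Arguments Var {R} a.
Arguments App {R Γ A b}.
Arguments Tup {R Γ A}.
Arguments Let {R Γ Θ δ γ δ' A b}.

Section Terms.
Variable R : signature.
Local Notation ty := (ty (atom R)).
Local Notation tmR := (tm R).
Local Notation sub := (homs tmR).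
Implicit Types (Γ Δ Θ γ δ A B l r : seq ty) (a b c : ty).

Definition vars A : sub A A := hids (@Var R) A.

(* Simultaneous substitution s{t1/x1, ..., tn/xn}; σ lists the t_i, whose
   contexts are concatenated.  Under a let, the bound variables are replaced by
   themselves. *)
Fixpoint subst Γ a Δ (s : tmR Γ a) {struct s} : sub Δ Γ -> tmR Δ a :=
  match s in tm _ X y return sub Δ X -> tmR Δ y with
  | Var a => fun σ => hhead σ
  | App X A b f ss => fun σ => App f (hcomp subst ss σ)
  | Tup X A ss => fun σ => Tup (hcomp subst ss σ)
  | Let X Y δ γ δ' A b e1 e2 s t => fun σ =>
      let: Splitting Δ1 Δ23 f1 σ1 σ23 := hsplit (hcastr e1 σ) in
      let: Splitting Δ2 Δ3 f2 σ2 σ3 := hsplit σ23 in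
      Let (etrans f1 (congr1 (cat Δ1) f2)) (erefl (Δ1 ++ A ++ Δ3))
        (subst s (hcastr (esym e2) (hcat σ1 erefl (hcat (vars A) erefl σ3))))
        (subst t σ2)
  end.

(* Contexts C with one hole: an element of ctx Γ0 a Γ b has a hole for terms of
   type a in context Γ0, and yields terms of type b in context Γ. *)
Inductive ctx (Γ0 : seq ty) (a : ty) : seq ty -> ty -> Type :=
| CHole : ctx Γ0 a Γ0 a
| CTup Γ Γ' Γ1 Γ2 Γ3 A1 c A2 : Γ = Γ1 ++ Γ' -> Γ' = Γ2 ++ Γ3 ->
    sub Γ1 A1 -> ctx Γ0 a Γ2 c -> sub Γ3 A2 -> ctx Γ0 a Γ (Ten (A1 ++ c :: A2))
| CApp Γ Γ' Γ1 Γ2 Γ3 A1 c A2 b : Γ = Γ1 ++ Γ' -> Γ' = Γ2 ++ Γ3 ->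
    marrow R (A1 ++ c :: A2) b ->
    sub Γ1 A1 -> ctx Γ0 a Γ2 c -> sub Γ3 A2 -> ctx Γ0 a Γ b
| CBody Γ Θ δ γ δ' A b : Γ = δ ++ γ ++ δ' -> Θ = δ ++ A ++ δ' ->
    ctx Γ0 a Θ b -> tmR γ (Ten A) -> ctx Γ0 a Γ b
| CArg Γ Θ δ γ δ' A b : Γ = δ ++ γ ++ δ' -> Θ = δ ++ A ++ δ' ->
    tmR Θ b -> ctx Γ0 a γ (Ten A) -> ctx Γ0 a Γ b.

Fixpoint plug Γ0 a Γ b (C : ctx Γ0 a Γ b) (u : tmR Γ0 a) : tmR Γ b :=
  match C in ctx _ _ X y return tmR X y with
  | CHole => u
  | CTup _ _ _ _ _ _ _ _ e e' ss C' ss' =>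
      Tup (hcat ss e (hcons e' (plug C' u) ss'))
  | CApp _ _ _ _ _ _ _ _ _ e e' f ss C' ss' =>
      App f (hcat ss e (hcons e' (plug C' u) ss'))
  | CBody _ _ _ _ _ _ _ e e' C' t => Let e e' (plug C' u) t
  | CArg _ _ _ _ _ _ _ e e' s C' => Let e e' s (plug C' u)
  end.

Definition is_hole Γ0 a Γ b (C : ctx Γ0 a Γ b) : bool :=
  if C is CHole then true else false.

Fixpoint is_E Γ0 a Γ b (C : ctx Γ0 a Γ b) : bool :=
  match C with
  | CHole => true
  | CTup _ _ _ _ _ _ _ _ _ _ _ C' _ => is_E C'
  | CApp _ _ _ _ _ _ _ _ _ _ _ _ _ C' _ => is_E C'
  | CBody _ _ _ _ _ _ _ _ _ C' _ => is_E C'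
  | CArg _ _ _ _ _ _ _ _ _ _ C' => ~~ is_hole C' && is_E C'
  end.

(* The contexts L = [.][x1 := t1]...[xn := tn]. *)
Inductive lctx (Γ0 : seq ty) : seq ty -> Type :=
| LHole : lctx Γ0 Γ0
| LLet Γ Θ δ γ δ' A : Γ = δ ++ γ ++ δ' -> Θ = δ ++ A ++ δ' ->
    lctx Γ0 Θ -> tmR γ (Ten A) -> lctx Γ0 Γ.

Fixpoint lplug Γ0 a Γ (L : lctx Γ0 Γ) (u : tmR Γ0 a) : tmR Γ a :=
  match L in lctx _ X return tmR X a with
  | LHole => u
  | LLet _ _ _ _ _ _ e e' L' t => Let e e' (lplug L' u) t
  end.

(* If L has a hole in context Γ0 and yields terms in context Γ, it can be
   plugged with a term having the additional variables l on the left and r on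
   the right, which are not bound by L. *)
Fixpoint lwiden l r Γ0 Γ (L : lctx Γ0 Γ) : lctx (l ++ Γ0 ++ r) (l ++ Γ ++ r) :=
  match L in lctx _ X return lctx (l ++ Γ0 ++ r) (l ++ X ++ r) with
  | LHole => LHole _
  | LLet Γ Θ δ γ δ' A e e' L' t =>
      LLet (δ := l ++ δ) (δ' := δ' ++ r)
        (etrans (congr1 (fun X => l ++ X ++ r) e) (widen_eq l δ γ δ' r))
        (etrans (congr1 (fun X => l ++ X ++ r) e') (widen_eq l δ A δ' r))
        (lwiden l r L') t
  end.

Definition is_LT Γ A (s : tmR Γ (Ten A)) : Prop :=
  exists Γ0 (L : lctx Γ0 Γ) (ss : sub Γ0 A), s = lplug L (Tup ss).

Inductive beta_root : forall Γ a, tmR Γ a -> tmR Γ a -> Prop :=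
| BetaRoot Γ0 γ δ δ' A b (s : tmR (δ ++ A ++ δ') b) (L : lctx Γ0 γ)
    (ss : sub Γ0 A) :
  beta_root (Let (erefl (δ ++ γ ++ δ')) erefl s (lplug L (Tup ss)))
    (lplug (lwiden δ δ' L)
      (subst s (hcat (vars δ) erefl (hcat ss erefl (vars δ'))))).

Inductive beta : forall Γ a, tmR Γ a -> tmR Γ a -> Prop :=
| BetaCtx Γ0 a Γ b (C : ctx Γ0 a Γ b) s s' :
  beta_root s s' -> beta (plug C s) (plug C s').

Inductive eta_root : forall Γ a, tmR Γ a -> tmR Γ a -> Prop :=
| EtaRoot Γ A (s : tmR Γ (Ten A)) : ~ is_LT s ->
  eta_root s (Let (δ := [::]) (δ' := [::]) (esym (cats0 Γ)) (esym (cats0 A))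
    (Tup (vars A)) s).

Inductive eta : forall Γ a, tmR Γ a -> tmR Γ a -> Prop :=
| EtaCtx Γ0 a Γ b (C : ctx Γ0 a Γ b) s s' :
  is_E C -> eta_root s s' -> eta (plug C s) (plug C s').

(* The side condition of structural equivalence: an element of
   fctx l r a L M b is a context whose hole expects a term of type a in context
   l ++ γ ++ r, none of the variables of γ being bound, and which then yields a
   term of type b in context L ++ γ ++ M.  It can be plugged for every γ: with
   the context of t (no free variable of t is bound), and with the variables
   bound by the let (which do not occur in the context).  The binder of a let
   around the hole lies entirely to the left of γ (FBodyl) or to its right
   (FBodyr). *)
Inductive fctx (l r : seq ty) (a : ty) : seq ty -> seq ty -> ty -> Type :=
| FHole : fctx l r a l r a
| FTup Γ1 Γ2 A1 c A2 L M : sub Γ1 A1 -> fctx l r a L M c -> sub Γ2 A2 ->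
    fctx l r a (Γ1 ++ L) (M ++ Γ2) (Ten (A1 ++ c :: A2))
| FApp Γ1 Γ2 A1 c A2 b L M : marrow R (A1 ++ c :: A2) b ->
    sub Γ1 A1 -> fctx l r a L M c -> sub Γ2 A2 ->
    fctx l r a (Γ1 ++ L) (M ++ Γ2) b
| FBodyl δ γ δ' A b M : fctx l r a (δ ++ A ++ δ') M b -> tmR γ (Ten A) ->
    fctx l r a (δ ++ γ ++ δ') M b
| FBodyr δ γ δ' A b L : fctx l r a L (δ ++ A ++ δ') b -> tmR γ (Ten A) ->
    fctx l r a L (δ ++ γ ++ δ') b
| FArg δ δ' A b L M : tmR (δ ++ A ++ δ') b -> fctx l r a L M (Ten A) ->
    fctx l r a (δ ++ L) (M ++ δ') b.

Fixpoint fplug l r a L M b (C : fctx l r a L M b) γ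
    (u : tmR (l ++ γ ++ r) a) : tmR (L ++ γ ++ M) b :=
  match C in fctx _ _ _ X Y y return tmR (X ++ γ ++ Y) y with
  | FHole => u
  | FTup Γ1 Γ2 A1 c A2 L M ss C' ss' =>
      Tup
        (hcat ss (esym (catA Γ1 L _))
          (hcons (right_eq L γ M Γ2) (fplug C' u) ss'))
  | FApp Γ1 Γ2 A1 c A2 b L M f ss C' ss' =>
      App f
        (hcat ss (esym (catA Γ1 L _))
          (hcons (right_eq L γ M Γ2) (fplug C' u) ss'))
  | FBodyl δ γ' δ' A b M C' t =>
      Let (left_eq δ γ' δ' (γ ++ M)) (left_eq δ A δ' (γ ++ M)) (fplug C' u) t
  | FBodyr δ γ' δ' A b L C' t =>
      Let (right_eq L γ δ (γ' ++ δ')) (right_eq L γ δ (A ++ δ')) (fplug C' u) t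
  | FArg δ δ' A b L M s C' =>
      Let (esym (widen_eq δ L γ M δ')) erefl s (fplug C' u)
  end.

Inductive struct : forall Γ a, tmR Γ a -> tmR Γ a -> Prop :=
| StructLet l r a L M b (C : fctx l r a L M b) γ A
    (s : tmR (l ++ A ++ r) a) (t : tmR γ (Ten A)) :
  struct (fplug C (Let erefl erefl s t)) (Let erefl erefl (fplug C s) t)
| StructRefl Γ a (s : tmR Γ a) : struct s s
| StructSym Γ a (s s' : tmR Γ a) : struct s s' -> struct s' s
| StructTrans Γ a (s s' s'' : tmR Γ a) :
  struct s s' -> struct s' s'' -> struct s s''
| StructCtx Γ0 a Γ b (C : ctx Γ0 a Γ b) (s s' : tmR Γ0 a) :
  struct s s' -> struct (plug C s) (plug C s').

Definition sim Γ a : tmR Γ a -> tmR Γ a -> Prop :=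
  clos_refl_sym_trans (tmR Γ a)
    (fun s s' => [\/ struct s s', beta s s' | eta s s']).
End Terms.

Section HomsTheory.
Variable O : Type.
Implicit Types (H : seq O -> O -> Type) (Γ Δ A B C : seq O) (a b c : O).

Lemma hcons_irr H Γ Γ1 Γ2 a A (e e' : Γ = Γ1 ++ Γ2) (g : H Γ1 a)
  (σ : homs H Γ2 A) : hcons e g σ = hcons e' g σ.
Proof. by rewrite (Prop_irrelevance e e'). Qed.

Lemma hcat_irr H Γ Γ1 Γ2 A B (e e' : Γ = Γ1 ++ Γ2) (σ : homs H Γ1 A)
  (τ : homs H Γ2 B) : hcat σ e τ = hcat σ e' τ.
Proof. by rewrite (Prop_irrelevance e e'). Qed.

Lemma hcast_id H Γ A (e : Γ = Γ) (σ : homs H Γ A) : hcast e σ = σ.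
Proof. by rewrite (Prop_irrelevance e erefl). Qed.

Lemma hcastr_id H Γ A (e : A = A) (σ : homs H Γ A) : hcastr e σ = σ.
Proof. by rewrite (Prop_irrelevance e erefl). Qed.

Lemma hnilP H Γ (σ : homs H Γ [::]) : exists e : [::] = Γ, σ = hcast e hnil.
Proof.
pose P X A : homs H X A -> Prop :=
  match A return homs H X A -> Prop with
  | [::] => fun σ => exists e : [::] = X, σ = hcast e hnil
  | _ => fun=> True end.
suff: P _ _ σ by [].
by case: σ => //=; exists erefl.
Qed.

Lemma hconsP H Γ a A (σ : homs H Γ (a :: A)) :
  exists Γ1 Γ2 (e : Γ = Γ1 ++ Γ2) g τ, σ = hcons e g τ.
Proof.
pose P X A : homs H X A -> Prop :=
  match A return homs H X A -> Prop with
  | [::] => fun=> True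
  | a :: A => fun σ => exists Γ1 Γ2 (e : X = Γ1 ++ Γ2) g τ, σ = hcons e g τ
  end.
suff: P _ _ σ by [].
by case: σ => //= X X1 X2 b B e g τ; exists X1, X2, e, g, τ.
Qed.

Lemma h1P H Γ a (σ : homs H Γ [:: a]) : exists g, σ = h1 g.
Proof.
have [Γ1 [Γ2 [e [g [τ ->]]]]] := hconsP σ.
have [e' ->] := hnilP τ; case: Γ2 / e' e τ => /= e _.
have e1 := e; rewrite cats0 in e1; subst Γ1.
by exists g; apply: hcons_irr.
Qed.

Lemma hhead_h1 H Γ a (g : H Γ a) : hhead (h1 g) = g.
Proof.
by rewrite /hhead /h1 /=; set e := esym _; rewrite (Prop_irrelevance e erefl).
Qed.

Lemma hsplit_hcat H Γ Γ1 Γ2 A B (e : Γ = Γ1 ++ Γ2) (σ : homs H Γ1 A)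
  (τ : homs H Γ2 B) : hsplit (hcat σ e τ) = Splitting e σ τ.
Proof.
elim: σ Γ e => [|X X1 X2 a A' e' g σ' IH] Γ e /=.
  by subst Γ.
subst X Γ; rewrite IH; congr Splitting; exact: Prop_irrelevance.
Qed.

Lemma hcat_hsplit H Γ A B (σ : homs H Γ (A ++ B)) :
  σ = hcat (sp_left (hsplit σ)) (sp_eq (hsplit σ)) (sp_right (hsplit σ)).
Proof.
elim: A Γ σ => [|a A IH] Γ σ //=.
have [Γ1 [Γ2 [e [g [τ ->]]]]] := hconsP σ.
rewrite /= {1}[τ]IH; case: (hsplit τ) => X1 X2 e' σ1 σ2 /=.
by subst Γ2; apply: hcons_irr.
Qed.

Lemma hcatP H Γ A B (σ : homs H Γ (A ++ B)) :
  exists Γ1 Γ2 (e : Γ = Γ1 ++ Γ2) σ1 σ2, σ = hcat σ1 e σ2.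
Proof. by do 5!eexists; apply: hcat_hsplit. Qed.

Lemma hcastr_cons H Γ Γ1 Γ2 a A A' (e : A = A') (e' : a :: A = a :: A')
    (f : Γ = Γ1 ++ Γ2) (g : H Γ1 a) (σ : homs H Γ2 A) :
  hcastr e' (hcons f g σ) = hcons f g (hcastr e σ).
Proof. by subst A'; rewrite !hcastr_id. Qed.

Lemma hcons_eq H Γ Γ1 Γ2 Γ2' a A (e : Γ = Γ1 ++ Γ2) (e' : Γ = Γ1 ++ Γ2')
    (g : H Γ1 a) (σ : homs H Γ2 A) (σ' : homs H Γ2' A) (f : Γ2 = Γ2') :
  hcast f σ = σ' -> hcons e g σ = hcons e' g σ'.
Proof. by subst Γ2' => /= <-; apply: hcons_irr. Qed.

Lemma hcast_hcastr H Γ Γ' A A' (e : Γ = Γ') (f : A = A') (σ : homs H Γ A) :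
  hcast e (hcastr f σ) = hcastr f (hcast e σ).
Proof. by subst Γ' A'. Qed.

Lemma hcast_hcat H Γ Γ' Γ1 Γ2 A B (f : Γ = Γ') (e : Γ = Γ1 ++ Γ2)
    (σ : homs H Γ1 A) (τ : homs H Γ2 B) :
  hcast f (hcat σ e τ) = hcat σ (etrans (esym f) e) τ.
Proof. by subst Γ'; apply: hcat_irr. Qed.

Lemma hcastr_comp H Γ A A' A'' (e : A = A') (f : A' = A'') (σ : homs H Γ A) :
  hcastr f (hcastr e σ) = hcastr (etrans e f) σ.
Proof. by subst A' A''. Qed.

Lemma hcatA H Γ Γ1 Γ2 Γ3 Γ12 Γ23 A B C (σ1 : homs H Γ1 A) (σ2 : homs H Γ2 B)
    (σ3 : homs H Γ3 C) (e1 : Γ12 = Γ1 ++ Γ2) (e2 : Γ = Γ12 ++ Γ3)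
    (e3 : Γ23 = Γ2 ++ Γ3) (e4 : Γ = Γ1 ++ Γ23)
    (e : (A ++ B) ++ C = A ++ B ++ C) :
  hcastr e (hcat (hcat σ1 e1 σ2) e2 σ3) = hcat σ1 e4 (hcat σ2 e3 σ3).
Proof.
elim: σ1 Γ Γ12 e1 e2 e4 e => [|X X1 X2 a A' e' g σ' IH] Γ Γ12 e1 e2 e4 e /=.
  by subst Γ12 Γ23 Γ; rewrite hcastr_id !hcast_id.
have eA : (A' ++ B) ++ C = A' ++ B ++ C by rewrite catA.
subst X Γ12 Γ23 Γ; rewrite (hcastr_cons eA).
apply: (@hcons_eq _ _ _ _ _ _ _ _ _ _ _ _ (esym (catA X2 Γ2 Γ3))).
by rewrite hcast_hcastr hcast_hcat; apply: IH.
Qed.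

Lemma hcat_nil H Γ A (σ : homs H Γ A) (e : Γ = Γ ++ [::]) (f : A ++ [::] = A) :
  hcastr f (hcat σ e hnil) = σ.
Proof.
elim: σ e f => [|X X1 X2 a A' g h σ IH] e f /=.
  by rewrite hcastr_id hcast_id.
subst X; rewrite (hcastr_cons (cats0 A')).
apply: (@hcons_eq _ _ _ _ _ _ _ _ _ _ _ _ (cats0 X2)).
by rewrite hcast_hcastr hcast_hcat; apply: IH.
Qed.

(* Families with arbitrary source and target, to rearrange concatenations. *)
Inductive packed H := Pack Γ A of homs H Γ A.
Arguments Pack {H Γ A}.

Definition pcat H (p q : packed H) : packed H :=
  let: Pack _ _ σ := p in let: Pack _ _ τ := q in Pack (hcat σ erefl τ).

Lemma pack_hcastr H Γ A A' (e : A = A') (σ : homs H Γ A) :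
  Pack (hcastr e σ) = Pack σ.
Proof. by subst A'. Qed.

Lemma pack_hcast H Γ Γ' A (e : Γ = Γ') (σ : homs H Γ A) :
  Pack (hcast e σ) = Pack σ.
Proof. by subst Γ'. Qed.

Lemma pack_hcat H Γ Γ1 Γ2 A B (e : Γ = Γ1 ++ Γ2) (σ : homs H Γ1 A)
  (τ : homs H Γ2 B) : Pack (hcat σ e τ) = pcat (Pack σ) (Pack τ).
Proof. by subst Γ. Qed.

Lemma pcatA H (p q r : packed H) : pcat p (pcat q r) = pcat (pcat p q) r.
Proof.
case: p q r => Γ1 A1 σ1 [Γ2 A2 σ2] [Γ3 A3 σ3] /=.
rewrite -[RHS](pack_hcastr (esym (catA A1 A2 A3))).
rewrite (hcatA _ _ _ _ _ erefl (esym (catA _ _ _))).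
rewrite -[LHS](pack_hcast (catA _ _ _)) hcast_hcat.
by congr Pack; apply: hcat_irr.
Qed.

Lemma pack_inj H Γ A A' (σ : homs H Γ A) (τ : homs H Γ A') (f : A = A') :
  Pack σ = Pack τ -> hcastr f σ = τ.
Proof.
subst A' => /= E.
suff: forall p : packed H, p = Pack τ ->
  forall (e1 : Γ = let: Pack X _ _ := p in X)
  (e2 : A = let: Pack _ Y _ := p in Y),
  hcastr e2 (hcast e1 τ) = let: Pack _ _ ρ := p in ρ.
  by move=> /(_ _ E erefl erefl) /= ->.
by move=> _ -> e1 e2; rewrite hcastr_id hcast_id.
Qed.

Lemma hids_cat H (id : forall a, H [:: a] a) A B :
  hids id (A ++ B) = hcat (hids id A) erefl (hids id B).
Proof.
elim: A => [|a A IH] //=; rewrite IH; exact: hcons_irr.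
Qed.

Section Comp.
Variables (H1 H2 H3 : seq O -> O -> Type).
Variable comp : forall Γ a Δ, H1 Γ a -> homs H2 Δ Γ -> H3 Δ a.
Arguments comp {Γ a Δ}.

Lemma hcomp_hcons Γ Γ1 Γ2 a A Δ Δ1 Δ2 (e : Γ = Γ1 ++ Γ2) (g : H1 Γ1 a)
  (σ : homs H1 Γ2 A) (e' : Δ = Δ1 ++ Δ2) (τ1 : homs H2 Δ1 Γ1)
  (τ2 : homs H2 Δ2 Γ2) (e2 : Γ1 ++ Γ2 = Γ) :
  hcomp (@comp) (hcons e g σ) (hcastr e2 (hcat τ1 e' τ2)) =
  hcons e' (comp g τ1) (hcomp (@comp) σ τ2).
Proof. by subst Γ; rewrite hcastr_id /= hsplit_hcat. Qed.

Lemma hcomp_hcat Γ Γ1 Γ2 A B Δ Δ1 Δ2 (e : Γ = Γ1 ++ Γ2) (σ1 : homs H1 Γ1 A)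
  (σ2 : homs H1 Γ2 B) (e' : Δ = Δ1 ++ Δ2) (τ1 : homs H2 Δ1 Γ1)
  (τ2 : homs H2 Δ2 Γ2) (e2 : Γ1 ++ Γ2 = Γ) :
  hcomp (@comp) (hcat σ1 e σ2) (hcastr e2 (hcat τ1 e' τ2)) =
  hcat (hcomp (@comp) σ1 τ1) e' (hcomp (@comp) σ2 τ2).
Proof.
elim: σ1 Γ Δ Δ1 e e' τ1 e2 => [|X X1 X2 a A' f g σ' IH] Γ Δ Δ1 e e' τ1 e2.
  case: (hnilP τ1) => f ->; subst Δ1 Γ Δ.
  by rewrite /= hcastr_id ?hcast_id.
subst X Γ; case: (hcatP τ1) => [Y1 [Y2 [f [τ11 [τ12 ->]]]]].
subst Δ1 Δ; rewrite [hcat (hcons _ _ _) _ _]/=.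
have -> : hcastr e2 (hcat (hcat τ11 erefl τ12) erefl τ2) =
   hcastr (catA X1 X2 Γ2) (hcat τ11 (esym (catA _ _ _)) (hcat τ12 erefl τ2)).
  rewrite hcastr_id -(hcatA τ11 τ12 τ2 erefl erefl erefl _ (esym (catA _ _ _))).
  by rewrite hcastr_comp hcastr_id.
rewrite hcomp_hcons /= hsplit_hcat /=; congr (hcons _ _ _).
  exact: Prop_irrelevance.
exact: (IH _ _ _ erefl erefl τ12 erefl).
Qed.
End Comp.

Lemma hcomp_hids H H' (comp : forall Γ a Δ, H Γ a -> homs H' Δ Γ -> H' Δ a)
    (id : forall a, H [:: a] a) :
  (forall Γ a (g : H' Γ a), comp _ _ _ (id a) (h1 g) = g) ->
  forall A Γ (σ : homs H' Γ A), hcomp comp (hids id A) σ = σ.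
Proof.
move=> idP; elim=> [|a A IH] Γ σ.
  by case: (hnilP σ) => e ->; case: Γ / e σ.
case: (hconsP σ) => Γ1 [Γ2 [e [g [τ ->]]]].
have -> : hcons e g τ = hcat (h1 g) e τ by subst Γ; apply: hcons_irr.
have -> : hcomp comp (hids id (a :: A)) (hcat (h1 g) e τ) =
  hcons e (comp _ _ _ (id a) (h1 g)) (hcomp comp (hids id A) τ).
  exact: (@hcomp_hcons _ _ _ comp _ [:: a] A a A _ _ _ erefl (id a)
    (hids id A) e (h1 g) τ erefl).
rewrite idP IH.
by subst Γ; apply: hcons_irr.
Qed.
End HomsTheory.

Fixpoint hall (O : Type) (H : seq O -> O -> Type)
    (P : forall Γ a, H Γ a -> Prop) Γ A (σ : homs H Γ A) : Prop :=
  match σ with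
  | hnil => True
  | hcons _ _ _ _ _ _ g σ' => P _ _ g /\ hall P σ'
  end.

Section TermsTheory.
Variable R : signature.
Local Notation ty := (ty (atom R)).
Local Notation tmR := (tm R).
Local Notation sub := (homs tmR).
Local Notation substs := (hcomp (@subst R)).
Implicit Types (Γ Δ Θ γ δ A B l r : seq ty) (a b c : ty).

Lemma tm_ind_all (P : forall Γ a, tmR Γ a -> Prop) :
  (forall a, P _ _ (Var a)) ->
  (forall Γ A b (f : marrow R A b) (ss : sub Γ A),
    hall P ss -> P _ _ (App f ss)) ->
  (forall Γ A (ss : sub Γ A), hall P ss -> P _ _ (Tup ss)) ->
  (forall Γ Θ δ γ δ' A b (e : Γ = δ ++ γ ++ δ') (e' : Θ = δ ++ A ++ δ')
    (s : tmR Θ b) (t : tmR γ (Ten A)),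
    P _ _ s -> P _ _ t -> P _ _ (Let e e' s t)) ->
  forall Γ a (s : tmR Γ a), P _ _ s.
Proof.
move=> Pvar Papp Ptup Plet; fix IH 3 => Γ a s.
pose IHs := fix IHs Γ A (ss : sub Γ A) : hall P ss :=
  match ss in homs _ X Y return hall P ss with
  | hnil => I
  | hcons _ _ _ _ _ _ g σ => conj (IH _ _ g) (IHs _ _ σ)
  end.
case: s => [b|X A b f ss|X A ss|X Y δ γ δ' A b e e' s t].
- exact: Pvar.
- exact/Papp/IHs.
- exact/Ptup/IHs.
- by apply: Plet; apply: IH.
Qed.

Lemma Let_irr Γ Θ δ γ δ' A b (e1 e2 : Γ = δ ++ γ ++ δ')
  (f1 f2 : Θ = δ ++ A ++ δ') (s : tmR Θ b) (t : tmR γ (Ten A)) :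
  Let e1 f1 s t = Let e2 f2 s t.
Proof. by rewrite (Prop_irrelevance e1 e2) (Prop_irrelevance f1 f2). Qed.

Lemma split3P Γ Δ γ1 γ2 γ3 (e : Γ = γ1 ++ γ2 ++ γ3) (σ : sub Δ Γ) :
  exists Δ1 Δ2 Δ3 (f : Δ = Δ1 ++ Δ2 ++ Δ3) (σ1 : sub Δ1 γ1) (σ2 : sub Δ2 γ2)
    (σ3 : sub Δ3 γ3), σ = hcastr (esym e) (hcat σ1 f (hcat σ2 erefl σ3)).
Proof.
subst Γ; case: (hcatP σ) => Δ1 [Δ23 [f [σ1 [σ23 ->]]]].
case: (hcatP σ23) => Δ2 [Δ3 [g [σ2 [σ3 ->]]]]; subst Δ23.
by exists Δ1, Δ2, Δ3, f, σ1, σ2, σ3.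
Qed.

Lemma subst_Let Γ Θ δ γ δ' A b (e1 : Γ = δ ++ γ ++ δ') (e2 : Θ = δ ++ A ++ δ')
    (s : tmR Θ b) (t : tmR γ (Ten A)) Δ Δ1 Δ2 Δ3 Ξ
    (f : Δ = Δ1 ++ Δ2 ++ Δ3) (σ1 : sub Δ1 δ) (σ2 : sub Δ2 γ) (σ3 : sub Δ3 δ')
    (f1 : δ ++ γ ++ δ' = Γ) (f2 : δ ++ A ++ δ' = Θ) (f' : Δ = Δ1 ++ Δ2 ++ Δ3)
    (g g' : Ξ = Δ1 ++ A ++ Δ3) :
  subst (Let e1 e2 s t) (hcastr f1 (hcat σ1 f (hcat σ2 erefl σ3))) =
  Let f' g (subst s (hcastr f2 (hcat σ1 g' (hcat (vars A) erefl σ3))))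
    (subst t σ2).
Proof.
subst Γ Θ Δ Ξ; rewrite ?hcastr_id /= ?hcastr_id !hsplit_hcat ?hcastr_id.
by rewrite (Prop_irrelevance g' erefl); apply: Let_irr.
Qed.

Lemma vars3 Γ γ1 γ2 γ3 (e e' : Γ = γ1 ++ γ2 ++ γ3) (f : γ1 ++ γ2 ++ γ3 = Γ) :
  vars Γ = hcastr f (hcat (vars γ1) e (hcat (vars γ2) erefl (vars γ3))).
Proof.
subst Γ; rewrite hcastr_id {1}/vars hids_cat (hids_cat _ γ2).
exact: hcat_irr.
Qed.

Lemma hcomp_vars_r_all Γ A (ss : sub Γ A) :
  hall (fun Γ _ s => subst s (vars Γ) = s) ss -> substs ss (vars Γ) = ss.
Proof.
elim: ss => [|X X1 X2 a B e s ss IH] //= [Es /IH Ess].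
subst X; rewrite /vars hids_cat /= hsplit_hcat.
by rewrite -/(vars _) Es Ess.
Qed.

Lemma subst_vars Γ a (s : tmR Γ a) : subst s (vars Γ) = s.
Proof.
elim/tm_ind_all: Γ a / s => [a|Γ A b f ss /hcomp_vars_r_all IH
  |Γ A ss /hcomp_vars_r_all IH|Γ Θ δ γ δ' A b e e' s t IHs IHt] //=.
- by rewrite /hhead /= (Prop_irrelevance (esym _) erefl).
- by rewrite IH.
- by rewrite IH.
rewrite -[RHS]/(Let e e' s t) -{2}IHs -{2}IHt.
rewrite -[LHS]/(subst (Let e e' s t) (vars Γ)).
rewrite (vars3 e e (esym e)) (subst_Let _ _ _ _ _ _ _ _ _ (esym e') e e' e').
by rewrite -vars3.
Qed.

Lemma hcomp_vars_r Γ A (ss : sub Γ A) : substs ss (vars Γ) = ss.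
Proof.
apply: hcomp_vars_r_all; elim: ss => //= X X1 X2 a B e s ss IH.
by split=> //; apply: subst_vars.
Qed.

Lemma subst_var a Γ (t : tmR Γ a) : subst (Var a) (h1 t) = t.
Proof. exact: hhead_h1. Qed.

Lemma hcomp_vars_l Γ A (ss : sub Γ A) : substs (vars A) ss = ss.
Proof. by apply: hcomp_hids => *; apply: subst_var. Qed.

Lemma hcomp_hcat' Γ1 Γ2 A B Δ Δ1 Δ2
  (σ1 : sub Γ1 A) (σ2 : sub Γ2 B) (e : Δ = Δ1 ++ Δ2) (τ1 : sub Δ1 Γ1)
  (τ2 : sub Δ2 Γ2) :
  substs (hcat σ1 erefl σ2) (hcat τ1 e τ2) =
  hcat (substs σ1 τ1) e (substs σ2 τ2).
Proof. exact: (hcomp_hcat (@subst R) erefl σ1 σ2 e τ1 τ2 erefl). Qed.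

Lemma hcomp_hcastr Γ A B Δ (e : A = B) (σ : sub Γ A) (τ : sub Δ Γ) :
  substs (hcastr e σ) τ = hcastr e (substs σ τ).
Proof. by subst B. Qed.

Definition subst_subst_at Γ a (s : tmR Γ a) := forall Δ Θ (σ : sub Δ Γ)
  (τ : sub Θ Δ), subst (subst s σ) τ = subst s (substs σ τ).

Lemma hcomp_assoc_all Γ A (ss : sub Γ A) : hall subst_subst_at ss ->
  forall Δ Θ (σ : sub Δ Γ) (τ : sub Θ Δ),
  substs (substs ss σ) τ = substs ss (substs σ τ).
Proof.
elim: ss => [|X X1 X2 a B e s ss IH] /=.
  move=> _ Δ Θ σ τ; case: (hnilP σ) τ => e ->; subst Δ => /= τ.
  by case: (hnilP τ) => f ->; subst Θ.
case=> Es /IH{}IH Δ Θ σ τ; subst X.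
case: (hcatP σ) τ => Δ1 [Δ2 [e [σ1 [σ2 ->]]]] τ; subst Δ.
case: (hcatP τ) => Θ1 [Θ2 [e [τ1 [τ2 ->]]]].
rewrite -/(hcomp _) hcomp_hcat' /= !hsplit_hcat.
rewrite -/(substs _ _) /= hsplit_hcat.
by rewrite Es IH.
Qed.

Lemma subst_subst Γ a (s : tmR Γ a) : subst_subst_at s.
Proof.
elim/tm_ind_all: Γ a / s => [a|Γ A b f ss /hcomp_assoc_all IH
  |Γ A ss /hcomp_assoc_all IH|Γ Θ δ γ δ' A b e e' s t IHs IHt] Δ Ξ σ τ.
- case: (h1P σ) => g ->; rewrite subst_var.
  rewrite -[substs _ _]/(substs (h1 g) τ).
  have -> : substs (h1 g) τ = h1 (subst g τ); last by rewrite subst_var.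
  rewrite -{1}[τ](hcat_nil τ (esym (cats0 _)) (cats0 Δ)).
  exact: (hcomp_hcons (@subst R)).
- by rewrite /= IH.
- by rewrite /= IH.
case: (split3P e σ) τ => Δ1 [Δ2 [Δ3 [f [σ1 [σ2 [σ3 ->]]]]]] τ.
case: (split3P f τ) => Ξ1 [Ξ2 [Ξ3 [g [τ1 [τ2 [τ3 ->]]]]]].
rewrite (subst_Let _ _ _ _ _ _ _ _ _ (esym e') f erefl erefl).
rewrite (subst_Let _ _ _ _ _ _ _ _ _ erefl g erefl erefl) IHs IHt.
rewrite !hcomp_hcastr.
have -> : substs (hcat σ1 f (hcat σ2 erefl σ3))
  (hcastr (esym f) (hcat τ1 g (hcat τ2 erefl τ3))) =
  hcat (substs σ1 τ1) g (hcat (substs σ2 τ2) erefl (substs σ3 τ3)).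
  by rewrite hcomp_hcat hcomp_hcat'.
rewrite (subst_Let _ _ _ _ _ _ _ _ _ (esym e') g erefl erefl).
by rewrite /= !hcomp_hcat' hcomp_vars_l.
Qed.
End TermsTheory.

Section SimTheory.
Variable R : signature.
Local Notation ty := (ty (atom R)).
Local Notation tmR := (tm R).
Local Notation sub := (homs tmR).
Local Notation substs := (hcomp (@subst R)).
Implicit Types (Γ Δ Θ γ δ A B l r : seq ty) (a b c : ty).

Lemma sim_refl Γ a (s : tmR Γ a) : sim s s.
Proof. exact: rst_refl. Qed.

Lemma sim_sym Γ a (s t : tmR Γ a) : sim s t -> sim t s.
Proof. exact: rst_sym. Qed.

Lemma sim_trans Γ a (s t u : tmR Γ a) : sim s t -> sim t u -> sim s u.
Proof. exact: rst_trans. Qed.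

Lemma sim_struct Γ a (s t : tmR Γ a) : struct s t -> sim s t.
Proof. by move=> st; apply: rst_step; constructor 1. Qed.

Lemma sim_beta Γ a (s t : tmR Γ a) : beta_root s t -> sim s t.
Proof.
by move=> st; apply: rst_step; constructor 2; exact: (BetaCtx (CHole _ _)).
Qed.

Lemma sim_eta Γ a (s t : tmR Γ a) : eta_root s t -> sim s t.
Proof.
by move=> st; apply: rst_step; constructor 3; exact: (EtaCtx (C := CHole _ _)).
Qed.

Lemma struct_eq Γ a (s s' t t' : tmR Γ a) :
  struct s t -> s = s' -> t = t' -> struct s' t'.
Proof. by move=> st <- <-. Qed.

Lemma Let_eq Γ Θ δ γ δ' A b (e1 e2 : Γ = δ ++ γ ++ δ')
  (f1 f2 : Θ = δ ++ A ++ δ') (s s' : tmR Θ b) (t t' : tmR γ (Ten A)) :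
  s = s' -> t = t' -> Let e1 f1 s t = Let e2 f2 s' t'.
Proof. by move=> <- <-; apply: Let_irr. Qed.

Lemma mid_irr Γ Γ' Γ'' Γ1 Γ2 Γ3 A1 c A2 (ss1 : sub Γ1 A1) (ss2 : sub Γ3 A2)
    (e1 : Γ = Γ1 ++ Γ') (e2 : Γ' = Γ2 ++ Γ3) (e1' : Γ = Γ1 ++ Γ'')
    (e2' : Γ'' = Γ2 ++ Γ3) (s s' : tmR Γ2 c) :
  s = s' ->
  hcat ss1 e1 (hcons e2 s ss2) = hcat ss1 e1' (hcons e2' s' ss2).
Proof. by subst Γ' Γ''; move=> <-; apply: hcat_irr. Qed.

Lemma struct_arg Γ Θ δ δ' γ' B b Θ' l m γ A L M Ξ
    (e1 : Γ = δ ++ γ' ++ δ') (e2 e2' : Θ = δ ++ B ++ δ')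
    (e3 : γ' = l ++ γ ++ m) (e4 : Θ' = l ++ A ++ m)
    (eL : L = δ ++ l) (eM : M = m ++ δ')
    (e5 : Γ = L ++ γ ++ M) (e6 : Ξ = L ++ A ++ M) (e7 : Ξ = δ ++ Θ' ++ δ')
    (r : tmR Θ b) (s : tmR Θ' (Ten B)) (t : tmR γ (Ten A)) :
  struct (Let e1 e2 r (Let e3 e4 s t)) (Let e5 e6 (Let e7 e2' r s) t).
Proof.
move: e1 e2 e7; subst γ' Θ' L M Γ Ξ => e1 e2 e7; subst Θ.
by apply: (struct_eq (StructLet (FArg r (FHole l m (Ten B))) s t));
  do ?apply: Let_eq.
Qed.

Lemma struct_body Γ Θ Σ Ξ δ δ' γ' B b γ A m D D' D2
    (e1 : Γ = δ ++ γ' ++ D) (e2 : Θ = δ ++ B ++ D)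
    (e3 : Θ = D' ++ γ ++ m) (e4 : Σ = D' ++ A ++ m)
    (eD : D = δ' ++ γ ++ m) (eD' : D' = δ ++ B ++ δ')
    (L := δ ++ γ' ++ δ') (eD2 : D2 = δ' ++ A ++ m)
    (e5 : Γ = L ++ γ ++ m) (e6 : Ξ = L ++ A ++ m)
    (e7 : Ξ = δ ++ γ' ++ D2) (e8 : Σ = δ ++ B ++ D2)
    (s : tmR Σ b) (t : tmR γ (Ten A)) (u : tmR γ' (Ten B)) :
  struct (Let e1 e2 (Let e3 e4 s t) u) (Let e5 e6 (Let e7 e8 s u) t).
Proof.
move: e1 e2 e7 e8; subst L D D' D2 Γ Θ Σ Ξ => e1 e2 e7 e8.
by apply: (struct_eq (StructLet (FBodyl (FHole (δ ++ B ++ δ') m b) u) s t));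
  do ?apply: Let_eq.
Qed.

Lemma struct_tup Γ Γ' Γ1 Γ2 Γ3 A1 c A2 Θ l m γ A L M Ξ Ξ'
    (ss1 : sub Γ1 A1) (ss2 : sub Γ3 A2)
    (e1 : Γ = Γ1 ++ Γ') (e2 : Γ' = Γ2 ++ Γ3)
    (e3 : Γ2 = l ++ γ ++ m) (e4 : Θ = l ++ A ++ m)
    (eL : L = Γ1 ++ l) (eM : M = m ++ Γ3)
    (e5 : Γ = L ++ γ ++ M) (e6 : Ξ = L ++ A ++ M) (e7 : Ξ = Γ1 ++ Ξ')
    (e8 : Ξ' = Θ ++ Γ3) (s : tmR Θ c) (t : tmR γ (Ten A)) :
  struct (Tup (hcat ss1 e1 (hcons e2 (Let e3 e4 s t) ss2)))
    (Let e5 e6 (Tup (hcat ss1 e7 (hcons e8 s ss2))) t).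
Proof.
move: e1 e7; subst Γ2 Θ L M Γ' Ξ' Γ Ξ => e1 e7.
apply: (struct_eq (StructLet (FTup ss1 (FHole l m c) ss2) s t)).
  by congr Tup; apply: mid_irr; apply: Let_irr.
by apply: Let_eq => //; congr Tup; apply: mid_irr.
Qed.

Lemma struct_app Γ Γ' Γ1 Γ2 Γ3 A1 c A2 b Θ l m γ A L M Ξ Ξ'
    (f : marrow R (A1 ++ c :: A2) b)
    (ss1 : sub Γ1 A1) (ss2 : sub Γ3 A2)
    (e1 : Γ = Γ1 ++ Γ') (e2 : Γ' = Γ2 ++ Γ3)
    (e3 : Γ2 = l ++ γ ++ m) (e4 : Θ = l ++ A ++ m)
    (eL : L = Γ1 ++ l) (eM : M = m ++ Γ3)
    (e5 : Γ = L ++ γ ++ M) (e6 : Ξ = L ++ A ++ M) (e7 : Ξ = Γ1 ++ Ξ')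
    (e8 : Ξ' = Θ ++ Γ3) (s : tmR Θ c) (t : tmR γ (Ten A)) :
  struct (App f (hcat ss1 e1 (hcons e2 (Let e3 e4 s t) ss2)))
    (Let e5 e6 (App f (hcat ss1 e7 (hcons e8 s ss2))) t).
Proof.
move: e1 e7; subst Γ2 Θ L M Γ' Ξ' Γ Ξ => e1 e7.
apply: (struct_eq (StructLet (FApp f ss1 (FHole l m c) ss2) s t)).
  by congr App; apply: mid_irr; apply: Let_irr.
by apply: Let_eq => //; congr App; apply: mid_irr.
Qed.

Lemma beta_Let Γ Θ δ γ δ' A b (e : Γ = δ ++ γ ++ δ') (e' : Θ = δ ++ A ++ δ')
    (s : tmR Θ b) (ss : sub γ A) :
  sim (Let e e' s (Tup ss))
    (subst s (hcastr (esym e') (hcat (vars δ) e (hcat ss erefl (vars δ'))))).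
Proof. by subst Γ Θ; apply: sim_beta; apply: (BetaRoot s (LHole γ) ss). Qed.

Fixpoint ctx_comp Γ0 a Γ1 b Γ c (C : ctx Γ1 b Γ c) (D : ctx Γ0 a Γ1 b) :
    ctx Γ0 a Γ c :=
  match C in ctx _ _ X y return ctx Γ0 a X y with
  | CHole => D
  | CTup _ _ _ _ _ _ _ _ e e' ss C' ss' => CTup e e' ss (ctx_comp C' D) ss'
  | CApp _ _ _ _ _ _ _ _ _ e e' f ss C' ss' =>
      CApp e e' f ss (ctx_comp C' D) ss'
  | CBody _ _ _ _ _ _ _ e e' C' t => CBody e e' (ctx_comp C' D) t
  | CArg _ _ _ _ _ _ _ e e' s C' => CArg e e' s (ctx_comp C' D)
  end.

Lemma plug_comp Γ0 a Γ1 b Γ c (C : ctx Γ1 b Γ c) (D : ctx Γ0 a Γ1 b) u :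
  plug (ctx_comp C D) u = plug C (plug D u).
Proof. by elim: C => //= *; congruence. Qed.

Lemma is_E_comp Γ0 a Γ1 b Γ c (C : ctx Γ1 b Γ c) (D : ctx Γ0 a Γ1 b) :
  is_E C -> is_E D -> is_E (ctx_comp C D).
Proof.
move=> + ED; elim: C => //= X Y δ γ δ' A d _ _ _ C IH /andP[nC /IH->].
by rewrite andbT; case: C {IH} nC.
Qed.

Lemma sim_E Γ0 a Γ b (C : ctx Γ0 a Γ b) s t :
  is_E C -> sim s t -> sim (plug C s) (plug C t).
Proof.
move=> EC; elim=> [{}s {}t [st|st|st]|{}s|{}s {}t _ IH|{}s t1 {}t _ IH1 _ IH2].
- exact/sim_struct/StructCtx.
- case: Γ0 a s t / st C {EC} => Γ1 c Γ0 a D s t st C; rewrite -!plug_comp.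
  by apply: rst_step; constructor 2; constructor.
- case: Γ0 a s t / st C EC => Γ1 c Γ0 a D s t ED st C EC; rewrite -!plug_comp.
  by apply: rst_step; constructor 3; constructor=> //; apply: is_E_comp.
- exact: sim_refl.
- exact: sim_sym.
- exact: sim_trans IH1 IH2.
Qed.

Lemma sim_tup Γ Γ' Γ1 Γ2 Γ3 A1 c A2 (e : Γ = Γ1 ++ Γ') (e' : Γ' = Γ2 ++ Γ3)
    (ss1 : sub Γ1 A1) (s t : tmR Γ2 c) (ss2 : sub Γ3 A2) : sim s t ->
  sim (Tup (hcat ss1 e (hcons e' s ss2))) (Tup (hcat ss1 e (hcons e' t ss2))).
Proof. exact: (@sim_E _ _ _ _ (CTup e e' ss1 (CHole _ _) ss2)). Qed.

Lemma sim_app Γ Γ' Γ1 Γ2 Γ3 A1 c A2 b (f : marrow R (A1 ++ c :: A2) b)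
    (e : Γ = Γ1 ++ Γ') (e' : Γ' = Γ2 ++ Γ3)
    (ss1 : sub Γ1 A1) (s t : tmR Γ2 c) (ss2 : sub Γ3 A2) : sim s t ->
  sim (App f (hcat ss1 e (hcons e' s ss2)))
    (App f (hcat ss1 e (hcons e' t ss2))).
Proof. exact: (@sim_E _ _ _ _ (CApp e e' f ss1 (CHole _ _) ss2)). Qed.

Lemma sim_body Γ Θ δ γ δ' A b (e : Γ = δ ++ γ ++ δ') (e' : Θ = δ ++ A ++ δ')
    (s s' : tmR Θ b) (t : tmR γ (Ten A)) :
  sim s s' -> sim (Let e e' s t) (Let e e' s' t).
Proof. exact: (@sim_E _ _ _ _ (CBody e e' (CHole _ _) t)). Qed.

Lemma sim_arg_eta Γ Θ δ γ δ' A b (e : Γ = δ ++ γ ++ δ') (e' : Θ = δ ++ A ++ δ')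
    (s : tmR Θ b) (t : tmR γ (Ten A)) (f : γ = [::] ++ γ ++ [::])
    (f' : A = [::] ++ A ++ [::]) :
  sim (Let e e' s t) (Let e e' s (Let f f' (Tup (vars A)) t)).
Proof.
apply: sim_sym.
apply: (sim_trans (t := Let e e' (Let e' e' s (Tup (vars A))) t)).
  apply: sim_struct.
  by apply: struct_arg => //; rewrite cats0.
apply: sim_body; rewrite -{2}[s]subst_vars (vars3 e' e' (esym e')).
exact: beta_Let.
Qed.

Lemma eta_rootP Γ A (s s' : tmR Γ (Ten A)) : eta_root s s' ->
  s' = Let (δ := [::]) (δ' := [::]) (esym (cats0 Γ)) (esym (cats0 A))
    (Tup (vars A)) s.
Proof.
suff H c (u u' : tmR Γ c) : eta_root u u' -> forall A (e : c = Ten A),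
  (let cast v := match e in _ = y return tmR Γ y with erefl => v end in
  cast u' = Let (δ := [::]) (δ' := [::]) (esym (cats0 Γ)) (esym (cats0 A))
    (Tup (vars A)) (cast u)).
  by move=> ss'; apply: (H _ _ _ ss' A erefl).
case=> {c u u'} Δ B u _ A' e /=; case: (e) => e'; subst A'.
by rewrite (Prop_irrelevance e erefl).
Qed.

Lemma eta_hole Γ0 a Γ b (C : ctx Γ0 a Γ b) s t :
  is_hole C -> eta_root s t -> eta_root (plug C s) (plug C t).
Proof. by case: C. Qed.

Lemma sim_arg Γ Θ δ γ δ' A b (e : Γ = δ ++ γ ++ δ') (e' : Θ = δ ++ A ++ δ')
    (s : tmR Θ b) (t t' : tmR γ (Ten A)) :
  sim t t' -> sim (Let e e' s t) (Let e e' s t').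
Proof.
pose F := CArg e e' s (CHole γ (Ten A)).
elim=> {t t'} [t t' [st|st|st]|t|t t' _ IH|t t1 t' _ IH1 _ IH2].
- exact: (sim_struct (StructCtx F st)).
- rewrite -[Let _ _ _ t]/(plug F t) -[Let _ _ _ t']/(plug F t').
  move: F; case: _ _ t t' / st => Γ0 c X d D u u' st F; rewrite -!plug_comp.
  by apply: rst_step; constructor 2; constructor.
- suff: eta_root t t' \/ sim (plug F t) (plug F t').
    by case=> // /eta_rootP ->; apply: sim_arg_eta.
  have: is_E (ctx_comp F (CHole γ (Ten A))) = false by [].
  have EF X y (D : ctx X y γ (Ten A)) : is_E D -> ~~ is_hole D ->
    is_E (ctx_comp F D) by move=> ED nD; rewrite /= nD.
  move: (F) EF; case: _ _ t t' / st => Γ0 c X d D u u' ED st G EG _.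
  case: (boolP (is_hole D)) => [hD|nD]; first by left; apply: eta_hole.
  right; rewrite -!plug_comp; apply: rst_step; constructor 3.
  by constructor=> //; apply: EG.
- exact: sim_refl.
- exact: sim_sym.
- exact: sim_trans IH1 IH2.
Qed.

Definition simS Γ a (s t : tmR Γ a) :=
  forall Δ (σ : sub Δ Γ), sim (subst s σ) (subst t σ).

Lemma simS_refl Γ a (s : tmR Γ a) : simS s s.
Proof. by move=> Δ σ; apply: sim_refl. Qed.

Lemma simS_sym Γ a (s t : tmR Γ a) : simS s t -> simS t s.
Proof. by move=> st Δ σ; apply: sim_sym. Qed.

Lemma simS_trans Γ a (s t u : tmR Γ a) : simS s t -> simS t u -> simS s u.
Proof. by move=> st tu Δ σ; apply: sim_trans (st _ σ) (tu _ σ). Qed.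

Lemma subst_mid Γ Γ' Γ1 Γ2 Γ3 A1 c A2 (e : Γ = Γ1 ++ Γ') (e' : Γ' = Γ2 ++ Γ3)
    (ss1 : sub Γ1 A1) (s : tmR Γ2 c) (ss2 : sub Γ3 A2) Δ Δ' Δ1 Δ2 Δ3
    (f : Γ1 ++ Γ2 ++ Γ3 = Γ) (g : Δ = Δ1 ++ Δ') (g' : Δ' = Δ2 ++ Δ3)
    (σ1 : sub Δ1 Γ1) (σ2 : sub Δ2 Γ2) (σ3 : sub Δ3 Γ3) :
  substs (hcat ss1 e (hcons e' s ss2)) (hcastr f (hcat σ1 g (hcat σ2 g' σ3))) =
  hcat (substs ss1 σ1) g (hcons g' (subst s σ2) (substs ss2 σ3)).
Proof.
subst Γ'; rewrite hcomp_hcat; congr (hcat _ _ _).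
exact: (hcomp_hcons (@subst R) erefl s ss2 g' σ2 σ3 erefl).
Qed.

Lemma simS_tup Γ Γ' Γ1 Γ2 Γ3 A1 c A2 (e : Γ = Γ1 ++ Γ') (e' : Γ' = Γ2 ++ Γ3)
    (ss1 : sub Γ1 A1) (s t : tmR Γ2 c) (ss2 : sub Γ3 A2) : simS s t ->
  simS (Tup (hcat ss1 e (hcons e' s ss2))) (Tup (hcat ss1 e (hcons e' t ss2))).
Proof.
move=> st Δ σ; have f : Γ = Γ1 ++ Γ2 ++ Γ3 by rewrite e e'.
case: (split3P f σ) => Δ1 [Δ2 [Δ3 [g [σ1 [σ2 [σ3 ->]]]]]].
by rewrite /= !subst_mid; apply: sim_tup.
Qed.

Lemma simS_app Γ Γ' Γ1 Γ2 Γ3 A1 c A2 b (f : marrow R (A1 ++ c :: A2) b)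
    (e : Γ = Γ1 ++ Γ') (e' : Γ' = Γ2 ++ Γ3)
    (ss1 : sub Γ1 A1) (s t : tmR Γ2 c) (ss2 : sub Γ3 A2) : simS s t ->
  simS (App f (hcat ss1 e (hcons e' s ss2)))
    (App f (hcat ss1 e (hcons e' t ss2))).
Proof.
move=> st Δ σ; have h : Γ = Γ1 ++ Γ2 ++ Γ3 by rewrite e e'.
case: (split3P h σ) => Δ1 [Δ2 [Δ3 [g [σ1 [σ2 [σ3 ->]]]]]].
by rewrite /= !subst_mid; apply: sim_app.
Qed.

Lemma simS_Let Γ Θ δ γ δ' A b (e : Γ = δ ++ γ ++ δ') (e' : Θ = δ ++ A ++ δ')
    (s s' : tmR Θ b) (t t' : tmR γ (Ten A)) :
  simS s s' -> simS t t' -> simS (Let e e' s t) (Let e e' s' t').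
Proof.
move=> ss' tt' Δ σ.
case: (split3P e σ) => Δ1 [Δ2 [Δ3 [g [σ1 [σ2 [σ3 ->]]]]]].
rewrite !(subst_Let _ _ _ _ _ _ _ _ _ (esym e') g erefl erefl).
by apply: sim_trans (sim_arg _ _ _ (tt' _ _)); apply: sim_body.
Qed.

Lemma simS_ctx Γ0 a Γ b (C : ctx Γ0 a Γ b) s t :
  simS s t -> simS (plug C s) (plug C t).
Proof.
move=> st; elim: C => //= *.
- exact: simS_tup.
- exact: simS_app.
- exact: simS_Let (simS_refl _).
- exact: simS_Let (simS_refl _) _.
Qed.

Ltac regroup := apply: pack_inj; rewrite ?(pack_hcat, pack_hcastr) ?pcatA //.

Lemma simS_floatarg Γ Θ δ δ' γ' B b Θ' l m γ A L M Ξ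
    (e1 : Γ = δ ++ γ' ++ δ') (e2 e2' : Θ = δ ++ B ++ δ')
    (e3 : γ' = l ++ γ ++ m) (e4 : Θ' = l ++ A ++ m)
    (eL : L = δ ++ l) (eM : M = m ++ δ')
    (e5 : Γ = L ++ γ ++ M) (e6 : Ξ = L ++ A ++ M) (e7 : Ξ = δ ++ Θ' ++ δ')
    (r : tmR Θ b) (s : tmR Θ' (Ten B)) (t : tmR γ (Ten A)) :
  simS (Let e1 e2 r (Let e3 e4 s t)) (Let e5 e6 (Let e7 e2' r s) t).
Proof.
move=> Δ σ.
case: (split3P e1 σ) => Δ1 [Δ2 [Δ3 [g [σ1 [σ2 [σ3 ->]]]]]].
case: (split3P e3 σ2) => X1 [X2 [X3 [h [τ1 [τ2 [τ3 ->]]]]]].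
have gX : Δ = (Δ1 ++ X1) ++ X2 ++ (X3 ++ Δ3) by rewrite g h -!catA.
rewrite (subst_Let _ _ _ _ _ _ _ _ _ (esym e2) g erefl erefl).
rewrite (subst_Let _ _ _ _ _ _ _ _ _ (esym e4) h erefl erefl).
have -> : hcastr (esym e1) (hcat σ1 g
    (hcat (hcastr (esym e3) (hcat τ1 h (hcat τ2 erefl τ3))) erefl σ3)) =
  hcastr (esym e5) (hcat (hcastr (esym eL) (hcat σ1 erefl τ1)) gX (hcat τ2 erefl
    (hcastr (esym eM) (hcat τ3 erefl σ3)))).
  regroup.
rewrite (subst_Let _ _ _ _ _ _ _ _ _ (esym e6) gX erefl erefl).
set ρ := hcastr (esym e6) _.
have gY : (Δ1 ++ X1) ++ A ++ X3 ++ Δ3 = Δ1 ++ (X1 ++ A ++ X3) ++ Δ3.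
  by rewrite -!catA.
have -> : ρ = hcastr (esym e7) (hcat σ1 gY (hcat
    (hcastr (esym e4) (hcat τ1 erefl (hcat (vars A) erefl τ3))) erefl σ3)).
  by rewrite {}/ρ; regroup.
rewrite (subst_Let _ _ _ _ _ _ _ _ _ (esym e2') gY erefl erefl).
rewrite (Prop_irrelevance e2 e2').
by apply: sim_struct; apply: struct_arg.
Qed.

Lemma simS_floattup Γ Γ' Γ1 Γ2 Γ3 A1 c A2 Θ l m γ A L M Ξ Ξ'
    (ss1 : sub Γ1 A1) (ss2 : sub Γ3 A2)
    (e1 : Γ = Γ1 ++ Γ') (e2 : Γ' = Γ2 ++ Γ3)
    (e3 : Γ2 = l ++ γ ++ m) (e4 : Θ = l ++ A ++ m)
    (eL : L = Γ1 ++ l) (eM : M = m ++ Γ3)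
    (e5 : Γ = L ++ γ ++ M) (e6 : Ξ = L ++ A ++ M) (e7 : Ξ = Γ1 ++ Ξ')
    (e8 : Ξ' = Θ ++ Γ3) (s : tmR Θ c) (t : tmR γ (Ten A)) :
  simS (Tup (hcat ss1 e1 (hcons e2 (Let e3 e4 s t) ss2)))
    (Let e5 e6 (Tup (hcat ss1 e7 (hcons e8 s ss2))) t).
Proof.
have f : Γ = Γ1 ++ Γ2 ++ Γ3 by rewrite e1 e2.
have f' : Ξ = Γ1 ++ Θ ++ Γ3 by rewrite e7 e8.
move=> Δ σ.
case: (split3P f σ) => Δ1 [Δ2 [Δ3 [g [σ1 [σ2 [σ3 ->]]]]]].
case: (split3P e3 σ2) => X1 [X2 [X3 [h [τ1 [τ2 [τ3 ->]]]]]].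
have gX : Δ = (Δ1 ++ X1) ++ X2 ++ (X3 ++ Δ3) by rewrite g h -!catA.
rewrite [subst (Tup _) _]/= subst_mid.
rewrite (subst_Let _ _ _ _ _ _ _ _ _ (esym e4) h erefl erefl).
have -> : hcastr (esym f) (hcat σ1 g
    (hcat (hcastr (esym e3) (hcat τ1 h (hcat τ2 erefl τ3))) erefl σ3)) =
  hcastr (esym e5) (hcat (hcastr (esym eL) (hcat σ1 erefl τ1)) gX (hcat τ2 erefl
    (hcastr (esym eM) (hcat τ3 erefl σ3)))).
  regroup.
rewrite (subst_Let _ _ _ _ _ _ _ _ _ (esym e6) gX erefl erefl).
set ρ := hcastr (esym e6) _.
have gY : (Δ1 ++ X1) ++ A ++ X3 ++ Δ3 = Δ1 ++ (X1 ++ A ++ X3) ++ Δ3.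
  by rewrite -!catA.
have -> : ρ = hcastr (esym f') (hcat σ1 gY (hcat
    (hcastr (esym e4) (hcat τ1 erefl (hcat (vars A) erefl τ3))) erefl σ3)).
  by rewrite {}/ρ; regroup.
by rewrite /= subst_mid; apply: sim_struct; apply: struct_tup.
Qed.

Lemma simS_floatapp Γ Γ' Γ1 Γ2 Γ3 A1 c A2 b Θ l m γ A L M Ξ Ξ'
    (f0 : marrow R (A1 ++ c :: A2) b)
    (ss1 : sub Γ1 A1) (ss2 : sub Γ3 A2)
    (e1 : Γ = Γ1 ++ Γ') (e2 : Γ' = Γ2 ++ Γ3)
    (e3 : Γ2 = l ++ γ ++ m) (e4 : Θ = l ++ A ++ m)
    (eL : L = Γ1 ++ l) (eM : M = m ++ Γ3)
    (e5 : Γ = L ++ γ ++ M) (e6 : Ξ = L ++ A ++ M) (e7 : Ξ = Γ1 ++ Ξ')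
    (e8 : Ξ' = Θ ++ Γ3) (s : tmR Θ c) (t : tmR γ (Ten A)) :
  simS (App f0 (hcat ss1 e1 (hcons e2 (Let e3 e4 s t) ss2)))
    (Let e5 e6 (App f0 (hcat ss1 e7 (hcons e8 s ss2))) t).
Proof.
have f : Γ = Γ1 ++ Γ2 ++ Γ3 by rewrite e1 e2.
have f' : Ξ = Γ1 ++ Θ ++ Γ3 by rewrite e7 e8.
move=> Δ σ.
case: (split3P f σ) => Δ1 [Δ2 [Δ3 [g [σ1 [σ2 [σ3 ->]]]]]].
case: (split3P e3 σ2) => X1 [X2 [X3 [h [τ1 [τ2 [τ3 ->]]]]]].
have gX : Δ = (Δ1 ++ X1) ++ X2 ++ (X3 ++ Δ3) by rewrite g h -!catA.
rewrite [subst (App _ _) _]/= subst_mid.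
rewrite (subst_Let _ _ _ _ _ _ _ _ _ (esym e4) h erefl erefl).
have -> : hcastr (esym f) (hcat σ1 g
    (hcat (hcastr (esym e3) (hcat τ1 h (hcat τ2 erefl τ3))) erefl σ3)) =
  hcastr (esym e5) (hcat (hcastr (esym eL) (hcat σ1 erefl τ1)) gX (hcat τ2 erefl
    (hcastr (esym eM) (hcat τ3 erefl σ3)))).
  regroup.
rewrite (subst_Let _ _ _ _ _ _ _ _ _ (esym e6) gX erefl erefl).
set ρ := hcastr (esym e6) _.
have gY : (Δ1 ++ X1) ++ A ++ X3 ++ Δ3 = Δ1 ++ (X1 ++ A ++ X3) ++ Δ3.
  by rewrite -!catA.
have -> : ρ = hcastr (esym f') (hcat σ1 gY (hcat
    (hcastr (esym e4) (hcat τ1 erefl (hcat (vars A) erefl τ3))) erefl σ3)).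
  by rewrite {}/ρ; regroup.
by rewrite /= subst_mid; apply: sim_struct; apply: struct_app.
Qed.

Lemma simS_floatbody Γ Θ Σ Ξ δ δ' γ' B b γ A m D D' D2 L
    (e1 : Γ = δ ++ γ' ++ D) (e2 : Θ = δ ++ B ++ D)
    (e3 : Θ = D' ++ γ ++ m) (e4 : Σ = D' ++ A ++ m)
    (eD : D = δ' ++ γ ++ m) (eD' : D' = δ ++ B ++ δ')
    (eL : L = δ ++ γ' ++ δ') (eD2 : D2 = δ' ++ A ++ m)
    (e5 : Γ = L ++ γ ++ m) (e6 : Ξ = L ++ A ++ m)
    (e7 : Ξ = δ ++ γ' ++ D2) (e8 : Σ = δ ++ B ++ D2)
    (s : tmR Σ b) (t : tmR γ (Ten A)) (u : tmR γ' (Ten B)) :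
  simS (Let e1 e2 (Let e3 e4 s t) u) (Let e5 e6 (Let e7 e8 s u) t).
Proof.
move=> Δ σ.
case: (split3P e1 σ) => Δ1 [Δ2 [Δ3 [g [σ1 [σ2 [σ3 ->]]]]]].
case: (split3P eD σ3) => X1 [X2 [X3 [h [τ1 [τ2 [τ3 ->]]]]]].
have gX : Δ = (Δ1 ++ Δ2 ++ X1) ++ X2 ++ X3 by rewrite g h -!catA.
have -> : hcastr (esym e1) (hcat σ1 g
    (hcat σ2 erefl (hcastr (esym eD) (hcat τ1 h (hcat τ2 erefl τ3))))) =
  hcastr (esym e5) (hcat (hcastr (esym eL) (hcat σ1 erefl (hcat σ2 erefl τ1)))
    gX (hcat τ2 erefl τ3)).
  regroup.
rewrite [in X in sim _ X](subst_Let _ _ _ _ _ _ _ _ _ (esym e6) gX erefl erefl).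
have -> : hcastr (esym e5) (hcat (hcastr (esym eL)
    (hcat σ1 erefl (hcat σ2 erefl τ1))) gX (hcat τ2 erefl τ3)) =
  hcastr (esym e1) (hcat σ1 g
    (hcat σ2 erefl (hcastr (esym eD) (hcat τ1 h (hcat τ2 erefl τ3))))).
  regroup.
rewrite (subst_Let _ _ _ _ _ _ _ _ _ (esym e2) g erefl erefl).
have gY : Δ1 ++ B ++ Δ3 = (Δ1 ++ B ++ X1) ++ X2 ++ X3 by rewrite h -!catA.
have -> : hcastr (esym e2) (hcat σ1 erefl (hcat (vars B) erefl
    (hcastr (esym eD) (hcat τ1 h (hcat τ2 erefl τ3))))) =
  hcastr (esym e3) (hcat (hcastr (esym eD')
    (hcat σ1 erefl (hcat (vars B) erefl τ1))) gY (hcat τ2 erefl τ3)).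
  regroup.
rewrite (subst_Let _ _ _ _ _ _ _ _ _ (esym e4) gY erefl erefl).
have gZ : (Δ1 ++ Δ2 ++ X1) ++ A ++ X3 = Δ1 ++ Δ2 ++ (X1 ++ A ++ X3).
  by rewrite -!catA.
have -> : hcastr (esym e6) (hcat (hcastr (esym eL)
    (hcat σ1 erefl (hcat σ2 erefl τ1))) erefl (hcat (vars A) erefl τ3)) =
  hcastr (esym e7) (hcat σ1 gZ (hcat σ2 erefl
    (hcastr (esym eD2) (hcat τ1 erefl (hcat (vars A) erefl τ3))))).
  regroup.
have gW : (Δ1 ++ B ++ X1) ++ A ++ X3 = Δ1 ++ B ++ (X1 ++ A ++ X3).
  by rewrite -!catA.
rewrite (subst_Let _ _ _ _ _ _ _ _ _ (esym e8) gZ gW gW).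
have -> : hcastr (esym e4) (hcat (hcastr (esym eD')
    (hcat σ1 erefl (hcat (vars B) erefl τ1))) erefl
    (hcat (vars A) erefl τ3)) =
  hcastr (esym e8) (hcat σ1 gW (hcat (vars B) erefl
    (hcastr (esym eD2) (hcat τ1 erefl (hcat (vars A) erefl τ3))))).
  regroup.
by apply: sim_struct; apply: struct_body.
Qed.

Lemma simS_fplug l r a L M b (C : fctx l r a L M b) γ A
    (s : tmR (l ++ A ++ r) a) (t : tmR γ (Ten A)) :
  simS (fplug C (Let erefl erefl s t)) (Let erefl erefl (fplug C s) t).
Proof.
elim: C => /= [|Γ1 Γ2 A1 c A2 L' M' ss1 C IH ss2
    |Γ1 Γ2 A1 c A2 d L' M' f ss1 C IH ss2
    |δ γ' δ' B d M' C IH u|δ γ' δ' B d L' C IH u|δ δ' B d L' M' u C IH].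
- exact: simS_refl.
- by apply: simS_trans (simS_tup _ _ _ _ IH) _; apply: simS_floattup.
- by apply: simS_trans (simS_app _ _ _ _ _ IH) _; apply: simS_floatapp.
- apply: simS_trans (simS_Let _ _ IH (simS_refl u)) _.
  by apply: simS_floatbody.
- apply: simS_trans (simS_Let _ _ IH (simS_refl u)) _.
  by apply: simS_sym; apply: simS_floatbody.
- apply: simS_trans (simS_Let _ _ (simS_refl u) IH) _.
  by apply: simS_floatarg.
Qed.

Lemma simS_struct Γ a (s t : tmR Γ a) : struct s t -> simS s t.
Proof.
elim=> {Γ a s t}.
- by move=> *; apply: simS_fplug.
- by move=> *; apply: simS_refl.
- by move=> *; apply: simS_sym.
- by move=> Γ a s t u _ st _ tu; apply: simS_trans st tu.
- by move=> *; apply: simS_ctx.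
Qed.

Lemma simS_beta_root Γ a (s t : tmR Γ a) : beta_root s t -> simS s t.
Proof.
case=> {Γ a s t} Γ0 γ δ δ' A b s L ss.
elim: L s ss => /= [|Γ Θ δ0 γ0 δ0' A0 e e' L IH t] s ss.
  move=> Δ σ; case: (split3P erefl σ) => Δ1 [Δ2 [Δ3 [g [σ1 [σ2 [σ3 ->]]]]]].
  rewrite (subst_Let _ _ _ _ _ _ _ _ _ erefl g erefl erefl).
  apply: sim_trans (beta_Let _ _ _ _) _.
  rewrite /= !subst_subst hcomp_hcat' hcomp_hcat' hcomp_vars_r hcomp_vars_r.
  rewrite hcomp_vars_l hcomp_hcat' hcomp_hcat' !hcomp_vars_l.
  exact: sim_refl.
apply: simS_trans (simS_Let _ _ (IH s ss) (simS_refl t)).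
by apply: simS_floatarg.
Qed.

Lemma sim_eta_all Γ A (t : tmR Γ (Ten A)) (f : Γ = [::] ++ Γ ++ [::])
    (f' : A = [::] ++ A ++ [::]) :
  sim t (Let f f' (Tup (vars A)) t).
Proof.
have [[Γ0 [L [ss ->]]]|nt] := pselect (is_LT t); last first.
  rewrite (Let_irr f (esym (cats0 Γ)) f' (esym (cats0 A))).
  by apply: sim_eta; constructor.
apply: sim_sym; elim: L f => {Γ t} /= [|Γ Θ δ γ δ' B e e' L IH t] f.
  apply: sim_trans (beta_Let _ _ _ _) _ => /=.
  rewrite hcomp_vars_l hcast_hcat [hcastr _ _](hcat_nil ss).
  exact: sim_refl.
have f1 : Θ = [::] ++ Θ ++ [::] by rewrite cats0.
apply: sim_trans (sim_body _ _ _ (IH f1)).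
by apply: sim_struct; apply: struct_arg; rewrite ?cats0.
Qed.

Lemma simS_eta_root Γ a (s t : tmR Γ a) : eta_root s t -> simS s t.
Proof.
case=> {Γ a s t} Γ A s _ Δ σ.
have f : Δ = [::] ++ Δ ++ [::] by rewrite cats0.
have {2}-> : σ = hcastr (cats0 Γ) (hcat (hnil : sub [::] [::]) f
    (hcat σ erefl hnil)).
  by rewrite /= hcast_hcat hcat_nil.
rewrite (@subst_Let R Γ A [::] Γ [::] A _ _ _ _ _ Δ [::] Δ [::] A f _ _ _ _
  (cats0 A) f (esym (cats0 A)) (esym (cats0 A))).
rewrite /= hcomp_vars_l hcast_hcat [hcastr _ _](hcat_nil (vars A)).
exact: sim_eta_all.
Qed.

Lemma sim_simS Γ a (s t : tmR Γ a) : sim s t -> simS s t.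
Proof.
elim=> {s t} [s t [|st|st]|s|s t _|s t u _ + _].
- exact: simS_struct.
- by case: Γ a s t / st => *; apply/simS_ctx/simS_beta_root.
- by case: Γ a s t / st => *; apply/simS_ctx/simS_eta_root.
- exact: simS_refl.
- exact: simS_sym.
- exact: simS_trans.
Qed.

Inductive sim_pair Γ a := SimPair (s t : tmR Γ a) of sim s t.

Definition sp1 Γ a (p : sim_pair Γ a) : tmR Γ a := let: SimPair s _ _ := p in s.
Definition sp2 Γ a (p : sim_pair Γ a) : tmR Γ a := let: SimPair _ t _ := p in t.
Definition sp_diag Γ a (s : tmR Γ a) : sim_pair Γ a := SimPair (sim_refl s).

Lemma sim_homs Γ A (ρ : homs sim_pair Γ A) Γ' b (G : sub Γ A -> tmR Γ' b) :
  (forall A1 c A2 (f : A1 ++ c :: A2 = A) Γ1 Γ2 Γ3 Γ'' (e : Γ = Γ1 ++ Γ'')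
     (e' : Γ'' = Γ2 ++ Γ3) (ss1 : sub Γ1 A1) (ss2 : sub Γ3 A2) s t, sim s t ->
     sim (G (hcastr f (hcat ss1 e (hcons e' s ss2))))
         (G (hcastr f (hcat ss1 e (hcons e' t ss2))))) ->
  sim (G (hmap1 sp1 ρ)) (G (hmap1 sp2 ρ)).
Proof.
elim: ρ Γ' b G => [|X X1 X2 a B e p ρ IH] Γ' b G GP /=; first exact: sim_refl.
apply: sim_trans (IH _ _ (fun τ => G (hcons e (sp2 p) τ)) _).
  case: p => s t st /=.
  exact: (GP [::] a B erefl [::] X1 X2 X erefl e hnil _ s t st).
move=> A1 c A2 f Γ1 Γ2 Γ3 Γ'' f1 f2 ss1 ss2 s t st.
have f' : a :: A1 ++ c :: A2 = a :: B by rewrite f.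
have g : X = (X1 ++ Γ1) ++ Γ'' by rewrite e f1 catA.
have := GP (a :: A1) c A2 f' _ _ _ _ g f2 (hcons erefl (sp2 p) ss1) ss2 s t st.
have E u : hcons e (sp2 p) (hcastr f (hcat ss1 f1 (hcons f2 u ss2))) =
    hcastr f' (hcat (hcons erefl (sp2 p) ss1) g (hcons f2 u ss2)).
  by rewrite /= (hcastr_cons f); subst X2 B; apply: hcons_irr.
by rewrite !E.
Qed.

Lemma hmap1_h1 (H H' : seq ty -> ty -> Type) (F : forall Γ a, H Γ a -> H' Γ a)
  Γ a (g : H Γ a) : hmap1 F (h1 g) = h1 (F _ _ g).
Proof. by []. Qed.

Lemma hmap1_hcat (H H' : seq ty -> ty -> Type) (F : forall Γ a, H Γ a -> H' Γ a)
  Γ Γ1 Γ2 A B (e : Γ = Γ1 ++ Γ2) (σ : homs H Γ1 A) (τ : homs H Γ2 B) :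
  hmap1 F (hcat σ e τ) = hcat (hmap1 F σ) e (hmap1 F τ).
Proof.
elim: σ Γ e => [|X X1 X2 a A' f g σ IH] Γ e /=; first by subst Γ.
by rewrite IH.
Qed.

Lemma hmap1_hids (H H' : seq ty -> ty -> Type) (F : forall Γ a, H Γ a -> H' Γ a)
    (id : forall a, H [:: a] a) (id' : forall a, H' [:: a] a) A :
  (forall a, F _ _ (id a) = id' a) -> hmap1 F (hids id A) = hids id' A.
Proof. by move=> E; elim: A => //= a A ->; rewrite E. Qed.

Lemma hmap1_comp (H H' H'' : seq ty -> ty -> Type)
  (F : forall Γ a, H Γ a -> H' Γ a) (G : forall Γ a, H' Γ a -> H'' Γ a) Γ A
  (σ : homs H Γ A) :
  hmap1 G (hmap1 F σ) = hmap1 (fun _ _ x => G _ _ (F _ _ x)) σ.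
Proof. by elim: σ => //= X X1 X2 a B e g σ ->. Qed.

Lemma hmap1_id (H : seq ty -> ty -> Type) (F : forall Γ a, H Γ a -> H Γ a) Γ A
  (σ : homs H Γ A) : (forall Γ a x, F Γ a x = x) -> hmap1 F σ = σ.
Proof. by move=> FE; elim: σ => //= X X1 X2 a B e g σ ->; rewrite FE. Qed.

Definition subst_sim_at Γ a (s : tmR Γ a) := forall Δ (ρ : homs sim_pair Δ Γ),
  sim (subst s (hmap1 sp1 ρ)) (subst s (hmap1 sp2 ρ)).

Lemma substs_sim_all Γ A (ss : sub Γ A) : hall subst_sim_at ss ->
  forall Δ (ρ : homs sim_pair Δ Γ), exists ρ' : homs sim_pair Δ A,
    hmap1 sp1 ρ' = substs ss (hmap1 sp1 ρ) /\
    hmap1 sp2 ρ' = substs ss (hmap1 sp2 ρ).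
Proof.
elim: ss => [|X X1 X2 a B e s ss IH] /=.
  move=> _ Δ ρ; case: (hnilP ρ) => e ->; subst Δ.
  by exists hnil.
case=> Ps /IH{}IH Δ ρ; subst X.
case: (hcatP ρ) => Δ1 [Δ2 [e [ρ1 [ρ2 ->]]]].
have [ρ' [E1 E2]] := IH _ ρ2.
exists (hcons e (SimPair (Ps _ ρ1)) ρ') => /=.
by rewrite !hmap1_hcat !hsplit_hcat E1 E2.
Qed.

Lemma subst_sim Γ a (s : tmR Γ a) : subst_sim_at s.
Proof.
elim/tm_ind_all: Γ a / s => [a|Γ A b f ss /substs_sim_all IH
  |Γ A ss /substs_sim_all IH|Γ Θ δ γ δ' A b e e' s t IHs IHt] Δ ρ.
- case: (h1P ρ) => -[s t st] ->.
  by rewrite !hmap1_h1 !subst_var.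
- rewrite /=; have [ρ' [<- <-]] := IH _ ρ.
  by apply: sim_homs => *; subst A; apply: sim_app.
- rewrite /=; have [ρ' [<- <-]] := IH _ ρ.
  by apply: sim_homs => *; subst A; apply: sim_tup.
subst Γ Θ; case: (hcatP ρ) => Δ1 [Δ23 [e [ρ1 [ρ23 ->]]]].
case: (hcatP ρ23) => Δ2 [Δ3 [e' [ρ2 [ρ3 ->]]]].
rewrite /= !hmap1_hcat !hsplit_hcat.
apply: sim_trans (sim_arg _ _ _ (IHt _ ρ2)); apply: sim_body.
have := IHs _
  (hcat ρ1 erefl (hcat (hids (fun a => sp_diag (Var a)) A) erefl ρ3)).
by rewrite !hmap1_hcat !(hmap1_hids (id' := @Var R)).
Qed.
End SimTheory.

Lemma cat_cons_eq (T : Type) (X Y γ δ : seq T) (c : T) : X ++ Y = γ ++ c :: δ ->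
  (exists δ1, X = γ ++ c :: δ1 /\ δ = δ1 ++ Y) \/
  (exists γ2, γ = X ++ γ2 /\ Y = γ2 ++ c :: δ).
Proof.
elim: X γ => [|x X IH] [|y γ] /=.
- by move=> ->; right; exists [::].
- by move=> ->; right; exists (y :: γ).
- by case=> -> <-; left; exists X.
case=> -> /IH [[δ1 [-> ->]]|[γ2 [-> ->]]].
  by left; exists δ1.
by right; exists γ2.
Qed.

Section Free.
Variable R : signature.
Local Notation ty := (ty (atom R)).
Local Notation tmR := (tm R).
Local Notation sub := (homs tmR).
Local Notation substs := (hcomp (@subst R)).
Implicit Types (Γ Δ Θ γ δ A B l r : seq ty) (a b c : ty).

Lemma hall_at (P : forall Γ a, tmR Γ a -> Prop) Γ A (ss : sub Γ A) γ c δ :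
  hall P ss -> Γ = γ ++ c :: δ ->
  exists A1 d A2 (f : A1 ++ d :: A2 = A) Γ1 γ2 δ2 Γ3 Γ' (e : Γ = Γ1 ++ Γ')
    (e' : Γ' = (γ2 ++ c :: δ2) ++ Γ3) (ss1 : sub Γ1 A1)
    (s : tmR (γ2 ++ c :: δ2) d) (ss2 : sub Γ3 A2),
  [/\ γ = Γ1 ++ γ2, δ = δ2 ++ Γ3, P _ _ s &
      ss = hcastr f (hcat ss1 e (hcons e' s ss2))].
Proof.
elim: ss γ => [|X X1 X2 a B e s ss IH] γ /=; first by case: γ.
case=> Ps Pss eX.
have eX' : X1 ++ X2 = γ ++ c :: δ by rewrite -e.
case: (cat_cons_eq eX') => [[δ1 [E1 E2]]|[γ2 [E1 E2]]].
  subst X1; exists [::], a, B, erefl, [::], γ, δ1, X2, X, erefl, e, hnil, s, ss.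
  by [].
have [A1 [d [A2 [f [Γ1 [γ3 [δ3 [Γ3 [Γ' [f1 [f2 [ss1 [t [ss2 H]]]]]]]]]]]]]] :=
  IH _ Pss E2.
case: H => F1 F2 Pt F3.
have g : X = (X1 ++ Γ1) ++ Γ' by rewrite e f1 catA.
have f' : a :: A1 ++ d :: A2 = a :: B by rewrite f.
exists (a :: A1), d, A2, f', (X1 ++ Γ1), γ3, δ3, Γ3, Γ', g, f2,
  (hcons erefl s ss1), t, ss2.
split=> //; first by rewrite E1 F1 catA.
rewrite /= (hcastr_cons f) F3 {IH E2 eX' F3 Pss}; subst B.
apply: (@hcons_eq _ _ _ _ _ _ _ _ _ _ _ _ _ f1).
by rewrite hcast_hcastr hcast_hcat; congr hcastr; apply: hcat_irr.
Qed.

Local Notation varre γ A δ := (hat (@Var R) γ δ (Tup (vars A))).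

Definition expand_at Γ b (s : tmR Γ b) := forall γ A δ
  (e : Γ = γ ++ Ten A :: δ) Ξ (f : Γ = γ ++ [:: Ten A] ++ δ)
  (f' : Ξ = γ ++ A ++ δ) (ρ : sub Ξ Γ),
  ρ = hcast (esym f') (hcastr (esym e) (varre γ A δ)) ->
  sim (Let f f' (subst s ρ) (Var (Ten A))) s.

Lemma pack_hcons (H : seq ty -> ty -> Type) Γ Γ1 Γ2 a A (e : Γ = Γ1 ++ Γ2)
  (g : H Γ1 a) (σ : homs H Γ2 A) :
  Pack (hcons e g σ) = pcat (Pack (h1 g)) (Pack σ).
Proof. by subst Γ => /=; congr Pack; apply: hcons_irr. Qed.

Lemma pcat_nill (H : seq ty -> ty -> Type) (p : packed H) :
  pcat (Pack hnil) p = p.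
Proof. by case: p. Qed.

Lemma pcat_nilr (H : seq ty -> ty -> Type) (p : packed H) :
  pcat p (Pack hnil) = p.
Proof.
case: p => Γ A σ /=; rewrite -(pack_hcastr (cats0 A)) -(pack_hcast (cats0 Γ)).
by rewrite hcast_hcastr hcast_hcat hcat_nil.
Qed.

Lemma pack_vars A B :
  Pack (vars (A ++ B)) = pcat (Pack (vars A)) (Pack (vars B)).
Proof. by rewrite /vars hids_cat pack_hcat. Qed.

Lemma pack_varre γ A δ : Pack (varre γ A δ) =
  pcat (pcat (Pack (vars γ)) (Pack (h1 (Tup (vars A))))) (Pack (vars δ)).
Proof. by rewrite /hat pack_hcat pack_hcons pcatA. Qed.

Lemma pack_inj' (H : seq ty -> ty -> Type) Γ Γ' A A' (σ : homs H Γ A)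
    (τ : homs H Γ' A') (e : Γ = Γ') (f : A = A') :
  Pack σ = Pack τ -> hcast e (hcastr f σ) = τ.
Proof. by subst Γ' => /= /(pack_inj f). Qed.

Lemma expand Γ b (s : tmR Γ b) : expand_at s.
Proof.
elim/tm_ind_all: Γ b / s => [a|Γ B b f ss IH
  |Γ B ss IH|Γ Θ θ ζ θ' B b e e' s t IHs IHt] γ A δ eΓ Ξ g g' ρ Eρ.
- have E := eΓ; case: γ eΓ E g g' Eρ => [|? []] //= eΓ [Ea Eδ].
  subst a δ => g g' Eρ.
  have f : A = [::] ++ A ++ [::] by rewrite cats0.
  have g'' : Ξ = A by rewrite g' cats0.
  move: g' Eρ; subst Ξ => g' Eρ; have -> : ρ = h1 (Tup (vars A)).
    rewrite Eρ; apply: pack_inj'; rewrite [LHS](pack_varre [::] A [::]).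
    by rewrite pcat_nill pcat_nilr.
  rewrite /= hhead_h1; exact: (sim_sym (sim_eta_all _ _ _)).
- have [A1 [d [A2 [h [Γ1 [γ2 [δ2 [Γ3 [Γ' [e [e' [ss1 [t [ss2 []]]]]]]]]]]]]]] :=
    hall_at IH eΓ.
  move=> Eγ Eδ IHt Ess; subst B γ δ ss.
  have k : Ξ = Γ1 ++ (γ2 ++ A ++ δ2) ++ Γ3 by rewrite g' -!catA.
  have h' : Γ1 ++ (γ2 ++ Ten A :: δ2) ++ Γ3 = Γ by rewrite e e'.
  have -> : ρ = hcastr h'
      (hcat (vars Γ1) k (hcat (varre γ2 A δ2) erefl (vars Γ3))).
    rewrite Eρ; apply: pack_inj'.
    rewrite ?(pack_hcastr, pack_hcat, pack_varre, pack_vars) -?/(vars _).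
    by rewrite ?(pcatA, pack_vars).
  rewrite /= subst_mid !hcomp_vars_r.
  have k2 : γ2 ++ Ten A :: δ2 = γ2 ++ [:: Ten A] ++ δ2 by [].
  have := IHt γ2 A δ2 erefl _ k2 erefl _ erefl.
  rewrite /= => /(sim_app f e e' ss1 ss2); apply: sim_trans.
  by apply/sim_sym/sim_struct/struct_app.
- have [A1 [d [A2 [h [Γ1 [γ2 [δ2 [Γ3 [Γ' [e [e' [ss1 [t [ss2 []]]]]]]]]]]]]]] :=
    hall_at IH eΓ.
  move=> Eγ Eδ IHt Ess; subst B γ δ ss.
  have k : Ξ = Γ1 ++ (γ2 ++ A ++ δ2) ++ Γ3 by rewrite g' -!catA.
  have h' : Γ1 ++ (γ2 ++ Ten A :: δ2) ++ Γ3 = Γ by rewrite e e'.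
  have -> : ρ = hcastr h'
      (hcat (vars Γ1) k (hcat (varre γ2 A δ2) erefl (vars Γ3))).
    rewrite Eρ; apply: pack_inj'.
    rewrite ?(pack_hcastr, pack_hcat, pack_varre, pack_vars) -?/(vars _).
    by rewrite ?(pcatA, pack_vars).
  rewrite /= subst_mid !hcomp_vars_r.
  have k2 : γ2 ++ Ten A :: δ2 = γ2 ++ [:: Ten A] ++ δ2 by [].
  have := IHt γ2 A δ2 erefl _ k2 erefl _ erefl.
  rewrite /= => /(sim_tup e e' ss1 ss2); apply: sim_trans.
  by apply/sim_sym/sim_struct/struct_tup.
rewrite -[LHS in sim LHS _]/(Let g g' _ _).
have eΓ' : θ ++ ζ ++ θ' = γ ++ Ten A :: δ by rewrite -e.
case: (cat_cons_eq eΓ') => [[δ1 [E1 E2]]|[γ2 [E1 E2]]].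
- subst θ δ.
  have k : Ξ = (γ ++ A ++ δ1) ++ ζ ++ θ' by rewrite g' -!catA.
  have k2 : (γ ++ A ++ δ1) ++ B ++ θ' = γ ++ A ++ δ1 ++ B ++ θ'.
    by rewrite -!catA.
  have k3 : Θ = γ ++ [:: Ten A] ++ δ1 ++ B ++ θ' by rewrite e' -!catA.
  have -> : ρ = hcastr (esym e)
      (hcat (varre γ A δ1) k (hcat (vars ζ) erefl (vars θ'))).
    rewrite Eρ; apply: pack_inj'.
    by rewrite ?(pack_hcastr, pack_hcat, pack_varre, pack_vars, pcatA).
  rewrite (subst_Let _ _ _ _ _ _ _ _ _ (esym e') k erefl erefl) subst_vars.
  set ρ' := hcastr (esym e') _.
  have H : sim (Let k3 k2 (subst s ρ') (Var (Ten A))) s.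
    apply: (IHs γ A (δ1 ++ B ++ θ') k3); apply/esym/pack_inj'.
    by rewrite ?(pack_hcastr, pack_hcat, pack_varre, pack_vars, pcatA).
  apply: sim_trans (sim_body e e' t H).
  by apply: sim_struct; apply: struct_body => //; rewrite -!catA.
case: (cat_cons_eq E2) => [[δ1 [F1 F2]]|[γ3 [F1 F2]]].
- subst γ ζ δ.
  have k : Ξ = θ ++ (γ2 ++ A ++ δ1) ++ θ' by rewrite g' -!catA.
  have k3 : γ2 ++ Ten A :: δ1 = γ2 ++ [:: Ten A] ++ δ1 by [].
  have -> : ρ = hcastr (esym e)
      (hcat (vars θ) k (hcat (varre γ2 A δ1) erefl (vars θ'))).
    rewrite Eρ; apply: pack_inj'.
    by rewrite ?(pack_hcastr, pack_hcat, pack_varre, pack_vars, pcatA).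
  rewrite (subst_Let _ _ _ _ _ _ _ _ _ (esym e') k e' e').
  rewrite -(vars3 e' e' (esym e')) subst_vars.
  have := IHt γ2 A δ1 erefl _ k3 erefl _ erefl.
  rewrite /= => /(sim_arg e e' s); apply: sim_trans.
  by apply/sim_sym/sim_struct/struct_arg.
subst γ γ2 θ'.
have k : Ξ = θ ++ ζ ++ (γ3 ++ A ++ δ) by rewrite g' -!catA.
have k2 : θ ++ B ++ γ3 ++ A ++ δ = (θ ++ B ++ γ3) ++ A ++ δ by rewrite -!catA.
have k3 : Θ = (θ ++ B ++ γ3) ++ [:: Ten A] ++ δ by rewrite e' -!catA.
have -> : ρ = hcastr (esym e)
    (hcat (vars θ) k (hcat (vars ζ) erefl (varre γ3 A δ))).
  rewrite Eρ; apply: pack_inj'.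
  by rewrite ?(pack_hcastr, pack_hcat, pack_varre, pack_vars, pcatA).
rewrite (subst_Let _ _ _ _ _ _ _ _ _ (esym e') k erefl erefl) subst_vars.
set ρ' := hcastr (esym e') _.
have H : sim (Let k3 k2 (subst s ρ') (Var (Ten A))) s.
  apply: (IHs (θ ++ B ++ γ3) A δ k3); apply/esym/pack_inj'.
  by rewrite ?(pack_hcastr, pack_hcat, pack_varre, pack_vars, pcatA).
apply: sim_trans (sim_body e e' t H).
by apply/sim_sym/sim_struct; apply: struct_body => //; rewrite -!catA.
Qed.

HB.instance Definition _ Γ a := gen_eqMixin (tmR Γ a).
HB.instance Definition _ Γ a := gen_choiceMixin (tmR Γ a).

Definition simb Γ a (s t : tmR Γ a) : bool := `[< sim s t >].

Lemma simb_refl Γ a : reflexive (@simb Γ a).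
Proof. by move=> s; apply/asboolP/sim_refl. Qed.

Lemma simb_sym Γ a : symmetric (@simb Γ a).
Proof.
by move=> s t; apply/idP/idP => /asboolP st; apply/asboolP/sim_sym.
Qed.

Lemma simb_trans Γ a : transitive (@simb Γ a).
Proof.
by move=> t s u /asboolP st /asboolP tu; apply/asboolP/(sim_trans st tu).
Qed.

Canonical sim_equiv Γ a :=
  EquivRel (@simb Γ a) (@simb_refl Γ a) (@simb_sym Γ a) (@simb_trans Γ a).

Local Open Scope quotient_scope.

Definition free_hom Γ a : Type := {eq_quot (sim_equiv Γ a)}.

Definition fclass Γ a (s : tmR Γ a) : free_hom Γ a :=
  \pi_({eq_quot (sim_equiv Γ a)}) s.

Definition frepr Γ a (f : free_hom Γ a) : tmR Γ a :=
  repr (f : {eq_quot (sim_equiv Γ a)}).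

Lemma fclass_repr Γ a (f : free_hom Γ a) : fclass (frepr f) = f.
Proof. exact: reprK. Qed.

Lemma fclass_eq Γ a (s t : tmR Γ a) : fclass s = fclass t <-> sim s t.
Proof.
split=> [/eqmodP /asboolP //|st].
by apply/eqmodP/asboolP.
Qed.

(* [s] o <[t1], ..., [tn]> = [s{t1/x1, ..., tn/xn}], see free_compE. *)
Definition free_comp Γ a Δ (f : free_hom Γ a) (σ : homs free_hom Δ Γ) :
    free_hom Δ a :=
  fclass (subst (frepr f) (hmap1 frepr σ)).

Lemma hmap1_fclassK Γ A (σ : homs free_hom Γ A) :
  hmap1 fclass (hmap1 frepr σ) = σ.
Proof. by rewrite hmap1_comp hmap1_id // => *; apply: fclass_repr. Qed.

Lemma free_compE Γ a Δ (s : tmR Γ a) (σ : sub Δ Γ) :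
  free_comp (fclass s) (hmap1 fclass σ) = fclass (subst s σ).
Proof.
have reprP X y (t : tmR X y) : sim (frepr (fclass t)) t.
  by apply/fclass_eq; rewrite fclass_repr.
pose F X y (t : tmR X y) := SimPair (reprP X y t).
apply/fclass_eq; rewrite hmap1_comp.
apply: sim_trans (sim_simS (reprP _ _ s) _) _.
have := subst_sim s (hmap1 F σ); rewrite !hmap1_comp.
by rewrite [X in sim _ (subst s X)]hmap1_id.
Qed.

Definition free_id a : free_hom [:: a] a := fclass (Var a).

Lemma hids_free A : hids free_id A = hmap1 fclass (vars A).
Proof. by rewrite (hmap1_hids (id' := free_id)). Qed.

Lemma hcomp_free Γ A Δ (σ : sub Γ A) (τ : sub Δ Γ) :
  hcomp free_comp (hmap1 fclass σ) (hmap1 fclass τ) =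
  hmap1 fclass (substs σ τ).
Proof.
elim: σ Δ τ => [|X X1 X2 a B e s σ IH] Δ τ.
  by case: (hnilP τ) => e ->; subst Δ.
subst X; case: (hcatP τ) => Δ1 [Δ2 [e [τ1 [τ2 ->]]]].
by rewrite /= hmap1_hcat !hsplit_hcat /= free_compE IH.
Qed.

Lemma free_comp_id1 Γ a (f : free_hom Γ a) : free_comp f (hids free_id Γ) = f.
Proof.
by rewrite -[f]fclass_repr hids_free free_compE subst_vars.
Qed.

Lemma free_comp_1id Γ a (g : free_hom Γ a) : free_comp (free_id a) (h1 g) = g.
Proof.
by rewrite -[g]fclass_repr -hmap1_h1 free_compE subst_var.
Qed.

Lemma free_comp_assoc Γ a Δ Θ (f : free_hom Γ a) (σ : homs free_hom Δ Γ)
    (τ : homs free_hom Θ Δ) :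
  free_comp (free_comp f σ) τ = free_comp f (hcomp free_comp σ τ).
Proof.
rewrite -[f]fclass_repr -[σ]hmap1_fclassK -[τ]hmap1_fclassK.
by rewrite hcomp_free !free_compE subst_subst.
Qed.

Definition free_multicategory : multicategory :=
  Multicategory free_comp_id1 free_comp_1id free_comp_assoc.

Definition free_re A : free_hom A (Ten A) := fclass (Tup (vars A)).

Lemma hat_free γ A δ : hat free_id γ δ (free_re A) = hmap1 fclass (varre γ A δ).
Proof. by rewrite /hat hmap1_hcat /= !hids_free. Qed.

Lemma free_re_bij γ A δ a :
  bijective (fun f : free_hom (γ ++ Ten A :: δ) a =>
    free_comp f (hat free_id γ δ (free_re A))).
Proof.
exists (fun g => fclass (Let (δ := γ) (γ := [:: Ten A]) (δ' := δ) erefl erefl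
    (frepr g) (Var (Ten A)))).
- move=> f; rewrite -{2}[f]fclass_repr -{1}[f]fclass_repr hat_free free_compE.
  set t := subst _ _; apply/fclass_eq.
  have tP : sim (frepr (fclass t)) t by apply/fclass_eq; rewrite fclass_repr.
  apply: sim_trans (sim_body _ _ _ tP) _.
  exact: (expand (frepr f) (e := erefl)).
move=> g; rewrite -{2}[g]fclass_repr hat_free free_compE.
apply/fclass_eq; set s := frepr g.
have -> : varre γ A δ =
    hcat (vars γ) erefl (hcat (h1 (Tup (vars A))) erefl (vars δ)).
  by congr hcat; apply: hcons_irr.
rewrite (@subst_Let R _ _ γ [:: Ten A] δ A _ erefl erefl s _ _ γ A δ _ erefl
   _ _ _ erefl erefl erefl erefl erefl).
rewrite subst_var -(vars3 erefl erefl erefl) subst_vars.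
apply: sim_trans (beta_Let _ _ _ _) _.
by rewrite -(vars3 erefl erefl erefl) subst_vars; apply: sim_refl.
Qed.

Definition free : rep_multicategory :=
  @RepMulticategory free_multicategory (@Ten (atom R)) free_re free_re_bij.

(* The class [f(x1, ..., xn)]. *)
Definition free_marrow A b (f : marrow R A b) : @hom free A b :=
  fclass (App f (vars A)).
End Free.

(* Main.v *)
Require Import Defs.
From mathcomp Require Import all_boot.
From mathcomp Require Import boolp.

(* Restricting S along i gives a representable multicategory on the types
   themselves, in which the tensor of A is Ten A; the functor i* is the
   interpretation of terms in it.  A let is interpreted by inverting the
   precomposition with re.  The interpretation turns substitution into
   composition, hence identifies structurally equivalent terms: both sides of
   C[s[x := t]] = C[s][x := t] are K o t for the arrow K with K o re = C[s].
   Beta and eta say that precomposition with re and its inverse are mutually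
   inverse.  Uniqueness: the let of a variable is the preimage of its body under
   precomposition with re, and every other term is obtained by substitution from
   variables, multiarrows and re. *)

Set Implicit Arguments.
Unset Strict Implicit.
Unset Printing Implicit Defensive.

(** * Families compared up to the associativity of concatenation *)

Section PackTheory.
Variable O : Type.
Implicit Types (H : seq O -> O -> Type) (Γ Δ A B : seq O) (a b : O).

Lemma pack_consE H Γ Γ1 Γ2 a A (e : Γ = Γ1 ++ Γ2) (g : H Γ1 a)
    (σ : homs H Γ2 A) :
  Pack (hcons e g σ) = pcat (Pack (h1 g)) (Pack σ).
Proof. by subst Γ => /=; congr Pack; apply: hcons_irr. Qed.

Lemma pack_hcat_hcons H Γ Γ' Γ1 Γ2 Γ3 A c B (e : Γ = Γ1 ++ Γ')
    (e' : Γ' = Γ2 ++ Γ3) (σ : homs H Γ1 A) (g : H Γ2 c) (τ : homs H Γ3 B) :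
  Pack (hcat σ e (hcons e' g τ)) =
  pcat (pcat (Pack σ) (Pack (h1 g))) (Pack τ).
Proof. by rewrite pack_hcat pack_consE pcatA. Qed.

Lemma pack_hids_cat H (id : forall a, H [:: a] a) A B :
  Pack (hids id (A ++ B)) = pcat (Pack (hids id A)) (Pack (hids id B)).
Proof. by rewrite hids_cat pack_hcat. Qed.

(** Packing loses nothing once sources and targets agree. Equations between families are therefore
    proved after packing, where [pcat] is strictly associative. *)
Lemma pack_eq H Γ A (σ τ : homs H Γ A) : Pack σ = Pack τ -> σ = τ.
Proof. exact: (@pack_inj _ _ _ _ _ _ _ erefl). Qed.

Lemma pack_dom H Γ Γ' A A' (σ : homs H Γ A) (τ : homs H Γ' A') :
  Pack σ = Pack τ -> Γ = Γ'.
Proof.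
by move=> /(congr1 (fun p : packed H => let: @Pack _ _ X _ _ := p in X)).
Qed.

Lemma pack_cod H Γ Γ' A A' (σ : homs H Γ A) (τ : homs H Γ' A') :
  Pack σ = Pack τ -> A = A'.
Proof.
by move=> /(congr1 (fun p : packed H => let: @Pack _ _ _ X _ := p in X)).
Qed.

Lemma hcomp_h1 H (comp : forall Γ a Δ, H Γ a -> homs H Δ Γ -> H Δ a)
    Γ a Δ (g : H Γ a) (τ : homs H Δ Γ) :
  hcomp comp (h1 g) τ = h1 (comp _ _ _ g τ).
Proof.
rewrite -{1}[τ](hcat_nil τ (esym (cats0 _)) (cats0 Γ)).
exact: hcomp_hcons.
Qed.

Lemma hcomp_hids_r H (comp : forall Γ a Δ, H Γ a -> homs H Δ Γ -> H Δ a)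
    (id : forall a, H [:: a] a) :
  (forall Γ a (f : H Γ a), comp _ _ _ f (hids id Γ) = f) ->
  forall Γ A (σ : homs H Γ A), hcomp comp σ (hids id Γ) = σ.
Proof.
move=> idP Γ A; elim=> [|X X1 X2 a B e g σ IH] //.
by subst X; rewrite hids_cat /= hsplit_hcat idP IH.
Qed.

Lemma pack_hcomp_cat H (comp : forall Γ a Δ, H Γ a -> homs H Δ Γ -> H Δ a)
    Γ Γ1 Γ2 A A1 A2 Δ Δ1 Δ2 (σ : homs H Γ A) (σ1 : homs H Γ1 A1)
    (σ2 : homs H Γ2 A2) (τ : homs H Δ Γ) (τ1 : homs H Δ1 Γ1)
    (τ2 : homs H Δ2 Γ2) :
  Pack σ = pcat (Pack σ1) (Pack σ2) -> Pack τ = pcat (Pack τ1) (Pack τ2) ->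
  Pack (hcomp comp σ τ) =
  pcat (Pack (hcomp comp σ1 τ1)) (Pack (hcomp comp σ2 τ2)).
Proof.
move=> Eσ Eτ; have eA : A = A1 ++ A2 := pack_cod Eσ.
have eΓ : Γ = Γ1 ++ Γ2 := pack_dom Eσ.
have eΔ : Δ = Δ1 ++ Δ2 := pack_dom Eτ.
subst A Γ Δ; rewrite (pack_eq Eσ) (pack_eq Eτ).
by rewrite (hcomp_hcat comp erefl σ1 σ2 erefl τ1 τ2 erefl) pack_hcat.
Qed.

(** Composition of families acts block by block. With packed hypotheses, the three blocks need only
    match up to reassociation of the contexts. *)
Lemma pack_hcomp_mid H (comp : forall Γ a Δ, H Γ a -> homs H Δ Γ -> H Δ a)
    Γ Γ1 Γ2 Γ3 A A1 a A3 Δ Δ1 Δ2 Δ3 (σ : homs H Γ A) (σ1 : homs H Γ1 A1)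
    (g : H Γ2 a) (σ3 : homs H Γ3 A3) (τ : homs H Δ Γ)
    (τ1 : homs H Δ1 Γ1) (τ2 : homs H Δ2 Γ2) (τ3 : homs H Δ3 Γ3) :
  Pack σ = pcat (pcat (Pack σ1) (Pack (h1 g))) (Pack σ3) ->
  Pack τ = pcat (pcat (Pack τ1) (Pack τ2)) (Pack τ3) ->
  Pack (hcomp comp σ τ) =
  pcat (pcat (Pack (hcomp comp σ1 τ1)) (Pack (h1 (comp _ _ _ g τ2))))
    (Pack (hcomp comp σ3 τ3)).
Proof.
move=> Eσ Eτ; rewrite -hcomp_h1.
rewrite -(pack_hcomp_cat comp (σ := hcat σ1 erefl (h1 g))
  (τ := hcat τ1 erefl τ2)) //.
exact: pack_hcomp_cat.
Qed.
End PackTheory.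

(** * Interpretation of terms in a representable multicategory on the types *)

Section Interpretation.
Variable R : signature.
Local Notation ty := (ty (atom R)).
Implicit Types (Γ Δ Θ Ξ γ δ A B l r : seq ty) (a b c : ty).

Variable H : seq ty -> ty -> Type.
Variable id : forall a, H [:: a] a.
Variable comp : forall Γ a Δ, H Γ a -> homs H Δ Γ -> H Δ a.
Arguments comp {Γ a Δ}.
Hypothesis comp_id1 : forall Γ a (f : H Γ a), comp f (hids id Γ) = f.
Hypothesis comp_1id : forall Γ a (g : H Γ a), comp (id a) (h1 g) = g.
Hypothesis comp_assoc : forall Γ a Δ Θ (f : H Γ a) (σ : homs H Δ Γ)
  (τ : homs H Θ Δ), comp (comp f σ) τ = comp f (hcomp (@comp) σ τ).
Variable re : forall A, H A (Ten A).
Hypothesis re_bij : forall γ A δ a,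
  bijective (fun f : H (γ ++ Ten A :: δ) a => comp f (hat id γ δ (re A))).
Variable mor : forall A b, marrow R A b -> H A b.

Local Notation ids := (hids id).
Local Notation comps := (hcomp (@comp)).

(** The family [hat], with its source given only up to an equation, as in the typing rule for
    lets. *)
Definition mid Γ δ γ δ' a (e : Γ = δ ++ γ ++ δ') (t : H γ a) :
    homs H Γ (δ ++ a :: δ') :=
  hcat (ids δ) e (hcons erefl t (ids δ')).

Lemma pack_mid Γ δ γ δ' a (e : Γ = δ ++ γ ++ δ') (t : H γ a) :
  Pack (mid e t) = pcat (pcat (Pack (ids δ)) (Pack (h1 t))) (Pack (ids δ')).
Proof. exact: pack_hcat_hcons. Qed.

(** Rewriting with these rules brings a packed family to a left-nested concatenation of blocks and
    absorbs identities. *)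
Definition packE := (pack_hcastr, pack_mid, pack_hcat_hcons, pack_hcat, pcatA,
  pack_hids_cat, hcomp_hids comp_1id, hcomp_hids_r comp_id1, comp_1id,
  comp_id1, hcomp_h1, pcat_nill, pcat_nilr).

(** * Inverting precomposition with [re] *)

Lemma unre_ex Θ δ A δ' b (e : Θ = δ ++ A ++ δ') (f : H Θ b) :
  exists g : H (δ ++ Ten A :: δ') b, comp g (mid e (re A)) = f.
Proof. by subst Θ; have [h _ hK] := re_bij δ A δ' b; exists (h f). Qed.

Definition unre Θ δ A δ' b (e : Θ = δ ++ A ++ δ') (f : H Θ b) :
    H (δ ++ Ten A :: δ') b := sval (cid (unre_ex e f)).

Lemma unreK Θ δ A δ' b (e : Θ = δ ++ A ++ δ') (f : H Θ b) :
  comp (unre e f) (mid e (re A)) = f.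
Proof. exact: svalP (cid (unre_ex e f)). Qed.

Lemma unre_uniq Θ δ A δ' b (e : Θ = δ ++ A ++ δ') (f : H Θ b)
    (g : H (δ ++ Ten A :: δ') b) :
  comp g (mid e (re A)) = f -> g = unre e f.
Proof.
move=> E; apply: (bij_inj (re_bij δ A δ' b)).
by subst Θ; rewrite -[RHS](unreK erefl f) in E *; rewrite -E.
Qed.

(** The bound variables are merged into a single one of type [Ten A], in whose place [g] is then
    put. *)
Definition letm Γ Θ δ γ δ' A b (e : Γ = δ ++ γ ++ δ')
    (e' : Θ = δ ++ A ++ δ') (f : H Θ b) (g : H γ (Ten A)) : H Γ b :=
  comp (unre e' f) (mid e g).

(** Naturality of the inverse in the variables that are not merged: precomposing either side with
    [re A] in the middle gives [comp f ρ], because [re A] and the families [σ1], [σ3] act on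
    disjoint blocks. *)
Lemma unre_comp Θ δ A δ' b (e : Θ = δ ++ A ++ δ') (f : H Θ b) Ξ Δ1 Δ3
    (g : Ξ = Δ1 ++ A ++ Δ3) (σ1 : homs H Δ1 δ) (σ3 : homs H Δ3 δ')
    (ρ : homs H Ξ Θ) :
  Pack ρ = pcat (pcat (Pack σ1) (Pack (ids A))) (Pack σ3) ->
  unre g (comp f ρ) =
  comp (unre e f) (hcat σ1 erefl (hcons (Γ1 := [:: Ten A]) erefl (id _) σ3)).
Proof.
move=> Eρ; apply/esym/unre_uniq; rewrite comp_assoc -{2}[f](unreK e) comp_assoc.
congr comp; apply: pack_eq.
rewrite (pack_hcomp_mid _ (pack_mid _ _) Eρ).
rewrite (pack_hcomp_mid (σ1 := σ1) (g := id _) (σ3 := σ3) _ _ (pack_mid _ _)).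
  by rewrite !packE.
by rewrite !packE.
Qed.

(** Arrows composed into [δ] and [δ'] pass to the body by [unre_comp], and those composed into [γ]
    pass to the argument. This gives both the let case of substitution and the commutation of lets
    with contexts. *)
Lemma letm_comp Γ Θ δ γ δ' A b (e : Γ = δ ++ γ ++ δ')
    (e' : Θ = δ ++ A ++ δ') (f : H Θ b) (t : H γ (Ten A))
    Δ Δ1 Δ2 Δ3 Ξ (h : Δ = Δ1 ++ Δ2 ++ Δ3) (g : Ξ = Δ1 ++ A ++ Δ3)
    (σ : homs H Δ Γ) (σ1 : homs H Δ1 δ) (σ2 : homs H Δ2 γ)
    (σ3 : homs H Δ3 δ') (ρ : homs H Ξ Θ) :
  Pack σ = pcat (pcat (Pack σ1) (Pack σ2)) (Pack σ3) ->
  Pack ρ = pcat (pcat (Pack σ1) (Pack (ids A))) (Pack σ3) ->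
  comp (letm e e' f t) σ = letm h g (comp f ρ) (comp t σ2).
Proof.
move=> Eσ Eρ; rewrite /letm (unre_comp e' _ _ Eρ) !comp_assoc.
congr comp; apply: pack_eq; rewrite (pack_hcomp_mid _ (pack_mid _ _) Eσ).
rewrite (pack_hcomp_mid (σ1 := σ1) (g := id _) (σ3 := σ3) _ _ (pack_mid _ _)).
  by rewrite !packE.
by rewrite !packE.
Qed.

Lemma letm_re Γ Θ δ γ δ' A b (e : Γ = δ ++ γ ++ δ')
    (e' : Θ = δ ++ A ++ δ') (f : H Θ b) (τ : homs H γ A) (ρ : homs H Γ Θ) :
  Pack ρ = pcat (pcat (Pack (ids δ)) (Pack τ)) (Pack (ids δ')) ->
  letm e e' f (comp (re A) τ) = comp f ρ.
Proof.
move=> Eρ; rewrite -{2}[f](unreK e') comp_assoc; congr comp; apply: pack_eq.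
by rewrite (pack_hcomp_mid _ (pack_mid _ _) Eρ) !packE.
Qed.

Lemma letm_eta Γ A (f : H Γ (Ten A)) (e : Γ = [::] ++ Γ ++ [::])
  (e' : A = [::] ++ A ++ [::]) : letm e e' (re A) f = f.
Proof.
(* The preimage of [re A] is the identity of [Ten A]. *)
rewrite /letm -(unre_uniq (δ := [::]) (δ' := [::]) (g := id (Ten A))).
  rewrite -[RHS]comp_1id; congr comp; apply: pack_eq.
  by rewrite pack_mid -[ids [::]]/hnil !packE.
rewrite -[RHS]comp_1id; congr comp; apply: pack_eq.
by rewrite pack_mid -[ids [::]]/hnil !packE.
Qed.

(** * Substitution becomes composition *)

Fixpoint interp Γ a (s : tm R Γ a) : H Γ a :=
  match s in tm _ X y return H X y with
  | Var a => id a
  | App X A b f ss => comp (mor f) (hmap1 interp ss)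
  | Tup X A ss => comp (re A) (hmap1 interp ss)
  | Let X Y δ γ δ' A b e e' s t => letm e e' (interp s) (interp t)
  end.

Lemma hmap1_vars A : hmap1 interp (vars A) = ids A.
Proof. exact: hmap1_hids. Qed.

Lemma interp_hcomp_all Γ A (ss : homs (tm R) Γ A) :
  hall (fun Γ _ s => forall Δ (σ : homs (tm R) Δ Γ),
    interp (subst s σ) = comp (interp s) (hmap1 interp σ)) ss ->
  forall Δ (σ : homs (tm R) Δ Γ),
  hmap1 interp (hcomp (@subst R) ss σ) =
  comps (hmap1 interp ss) (hmap1 interp σ).
Proof.
elim: ss => [|X X1 X2 a B e s ss IH] /=.
  by move=> _ Δ σ; case: (hnilP σ) => e ->; subst Δ.
case=> Es /IH{}IH Δ σ; subst X.
case: (hcatP σ) => Δ1 [Δ2 [e [σ1 [σ2 ->]]]].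
by rewrite /= hmap1_hcat !hsplit_hcat /= Es IH.
Qed.

Lemma pack_hmap1_hcastr Γ A A' (e : A = A') (σ : homs (tm R) Γ A) :
  Pack (hmap1 interp (hcastr e σ)) = Pack (hmap1 interp σ).
Proof. by subst A'. Qed.

Lemma interp_subst Γ a (s : tm R Γ a) Δ (σ : homs (tm R) Δ Γ) :
  interp (subst s σ) = comp (interp s) (hmap1 interp σ).
Proof.
elim/tm_ind_all: Γ a / s Δ σ => [a|Γ A b f ss /interp_hcomp_all IH
  |Γ A ss /interp_hcomp_all IH|Γ Θ δ γ δ' A b e e' s t IHs IHt] Δ σ.
- by case: (h1P σ) => g ->; rewrite subst_var hmap1_h1 comp_1id.
- by rewrite /= IH comp_assoc.
- by rewrite /= IH comp_assoc.
case: (split3P e σ) => Δ1 [Δ2 [Δ3 [f [σ1 [σ2 [σ3 ->]]]]]].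
rewrite (subst_Let _ _ _ _ _ _ _ _ _ (esym e') f erefl erefl) /= IHs IHt.
by apply/esym/letm_comp; rewrite pack_hmap1_hcastr !hmap1_hcat ?hmap1_vars !packE.
Qed.

(** * Invariance of the interpretation under [sim] *)

Lemma interp_plug Γ0 a Γ b (C : ctx Γ0 a Γ b) (s s' : tm R Γ0 a) :
  interp s = interp s' -> interp (plug C s) = interp (plug C s').
Proof. by move=> E; elim: C => //= *; rewrite ?hmap1_hcat /=; congruence. Qed.

(** The context [C] leaves the middle segment of the hole untouched, so composing an arrow into that
    segment commutes with plugging. The let cases are instances of [letm_comp]. *)
Lemma interp_fplug_mid l r a L M b (C : fctx l r a L M b) c γ (t : H γ c)
    (u : tm R (l ++ [:: c] ++ r) a) (v : tm R (l ++ γ ++ r) a) :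
  interp v = comp (interp u) (mid erefl t) ->
  interp (fplug C v) = comp (interp (fplug C u)) (mid erefl t).
Proof.
move=> E; elim: C => /= [|Γ1 Γ2 A1 d A2 L' M' ss1 C IH ss2
    |Γ1 Γ2 A1 d A2 d' L' M' f ss1 C IH ss2
    |δ γ' δ' B d M' C IH w|δ γ' δ' B d L' C IH w|δ δ' B d L' M' w C IH].
- exact: E.
- rewrite comp_assoc; congr comp; apply: pack_eq.
  rewrite !hmap1_hcat /= IH.
  rewrite (pack_hcomp_mid _ (σ1 := hmap1 interp ss1)
    (g := interp (fplug C u)) (σ3 := hmap1 interp ss2) (τ1 := ids Γ1)
    (τ2 := mid erefl t) (τ3 := ids Γ2)).
  + by rewrite !packE.
  + by rewrite !packE.
  + by rewrite !packE.
- rewrite comp_assoc; congr comp; apply: pack_eq.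
  rewrite !hmap1_hcat /= IH.
  rewrite (pack_hcomp_mid _ (σ1 := hmap1 interp ss1)
    (g := interp (fplug C u)) (σ3 := hmap1 interp ss2) (τ1 := ids Γ1)
    (τ2 := mid erefl t) (τ3 := ids Γ2)).
  + by rewrite !packE.
  + by rewrite !packE.
  + by rewrite !packE.
(* Here [t] lies to the right of the binder and belongs to [σ3]; in the next case it lies to the
   left and belongs to [σ1]; in the last one it enters the argument of the let. *)
- rewrite IH -{1}[interp w]comp_id1; apply: esym; apply: (letm_comp _ _ _ _ _ _
    (σ1 := ids δ)
    (σ3 := hcat (ids δ') erefl (hcons erefl t (ids M')))).
  + by rewrite !packE.
  + by rewrite !packE.
- rewrite IH -{1}[interp w]comp_id1; apply: esym; apply: (letm_comp _ _ _ _ _ _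
    (σ1 := hcat (ids L') erefl (hcat (h1 t) erefl (ids δ)))
    (σ3 := ids δ')).
  + by rewrite !packE.
  + by rewrite !packE.
- rewrite IH -{1}[interp w]comp_id1; apply: esym; apply: (letm_comp _ _ _ _ _ _
    (σ1 := ids δ) (σ3 := ids δ')).
  + by rewrite !packE.
  + by rewrite !packE.
Qed.

Lemma letm_id Θ δ A δ' b (e' : Θ = δ ++ A ++ δ') (f : H Θ b) :
  letm erefl e' f (id (Ten A)) = unre e' f.
Proof.
rewrite /letm -[RHS]comp_id1; congr comp; exact: (esym (hids_cat _ _ _)).
Qed.

Lemma interp_fplug_Let l r a L M b (C : fctx l r a L M b) γ A
    (s : tm R (l ++ A ++ r) a) (t : tm R γ (Ten A)) :
  interp (fplug C (Let erefl erefl s t)) =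
  interp (Let erefl erefl (fplug C s) t).
Proof.
(* With a fresh variable as its argument, the let is interpreted by the preimage of [interp s]
   alone. *)
pose u : tm R (l ++ [:: Ten A] ++ r) a := Let erefl erefl s (Var (Ten A)).
have uE : interp u = unre erefl (interp s) by apply: letm_id.
rewrite (interp_fplug_mid (t := interp t) C (u := u)); last by rewrite uE.
(* The same lemma, now with [re A] in place of [interp t], shows that [fplug C u] is the preimage of
   [fplug C s]. *)
congr comp; apply: unre_uniq; apply/esym/interp_fplug_mid.
by rewrite uE unreK.
Qed.

Lemma interp_struct Γ a (s t : tm R Γ a) : struct s t -> interp s = interp t.
Proof.
elim=> {Γ a s t} //; first by move=> *; apply: interp_fplug_Let.
  by move=> Γ a s t u _ -> _ ->.
by move=> *; apply: interp_plug.
Qed.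

Lemma interp_beta Γ a (s t : tm R Γ a) : beta_root s t -> interp s = interp t.
Proof.
case=> {Γ a s t} Γ0 γ δ δ' A b s L ss.
elim: L s ss => /= [|Γ Θ δ0 γ0 δ0' A0 e e' L IH t] s ss.
  rewrite interp_subst; apply: letm_re.
  by rewrite !hmap1_hcat !hmap1_vars !packE.
(* Structural equivalence moves the outermost let of the list context out of the argument, which
   leaves a redex with a shorter list context. *)
rewrite -IH -[RHS]/(interp (Let _ _ (Let erefl erefl s _) t)).
by apply: (interp_struct (s := Let _ _ s (Let e e' _ t))); apply: struct_arg.
Qed.

Lemma interp_eta Γ a (s t : tm R Γ a) : eta_root s t -> interp s = interp t.
Proof.
by case=> {Γ a s t} Γ A s _; rewrite /= hmap1_vars comp_id1 letm_eta.
Qed.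

Lemma interp_sim Γ a (s t : tm R Γ a) : sim s t -> interp s = interp t.
Proof.
elim=> {s t} [s t [|st|st]|s|s t _|s t u _ -> _ ->] //.
- exact: interp_struct.
- by case: Γ a s t / st => *; apply/interp_plug/interp_beta.
- by case: Γ a s t / st => *; apply/interp_plug/interp_eta.
Qed.

Definition free_interp Γ a (f : free_hom Γ a) : H Γ a := interp (frepr f).

Lemma free_interpE Γ a (s : tm R Γ a) : free_interp (fclass s) = interp s.
Proof. by apply/interp_sim/fclass_eq/fclass_repr. Qed.

Lemma free_interp_comp Γ a Δ (f : free_hom Γ a) (σ : homs (@free_hom R) Δ Γ) :
  free_interp (free_comp f σ) = comp (free_interp f) (hmap1 free_interp σ).
Proof. by rewrite free_interpE interp_subst hmap1_comp. Qed.

(** * Uniqueness of the interpretation *)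

Section Uniqueness.
Variable G : forall Γ a, free_hom Γ a -> H Γ a.
Arguments G {Γ a}.
Hypothesis G_id : forall a, G (free_id a) = id a.
Hypothesis G_comp : forall Γ a Δ (f : free_hom Γ a)
  (σ : homs (@free_hom R) Δ Γ),
  G (free_comp f σ) = comp (G f) (hmap1 (@G) σ).
Hypothesis G_re : forall A, G (free_re A) = re A.
Hypothesis G_mor : forall A b (f : marrow R A b), G (free_marrow f) = mor f.

Lemma G_subst Γ a Δ (s : tm R Γ a) (σ : homs (tm R) Δ Γ) :
  G (fclass (subst s σ)) =
  comp (G (fclass s)) (hmap1 (fun _ _ t => G (fclass t)) σ).
Proof. by rewrite -free_compE G_comp hmap1_comp. Qed.

Lemma G_all Γ A (ss : homs (tm R) Γ A) :
  hall (fun _ _ s => G (fclass s) = interp s) ss ->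
  hmap1 (fun _ _ t => G (fclass t)) ss = hmap1 interp ss.
Proof. by elim: ss => //= X X1 X2 a B e s ss IH [-> /IH->]. Qed.

(** This reduces the let case of uniqueness to lets of a variable, since [G] turns substitution into
    composition. *)
Lemma subst_Let_var Γ Θ δ γ δ' A b (e : Γ = δ ++ γ ++ δ')
    (e' : Θ = δ ++ A ++ δ') (s : tm R Θ b) (t : tm R γ (Ten A)) :
  subst (Let (γ := [:: Ten A]) erefl e' s (Var (Ten A)))
    (hcat (vars δ) e (hcons erefl t (vars δ'))) = Let e e' s t.
Proof.
have -> : hcons erefl t (vars δ') = hcat (h1 t) erefl (vars δ').
  exact: hcons_irr.
rewrite (@subst_Let R _ _ δ [:: Ten A] δ' A _ erefl e' s _ _ δ γ δ' _ e
  _ _ _ erefl (esym e') e e' e').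
by rewrite subst_var -(vars3 e' e' (esym e')) subst_vars.
Qed.

Lemma G_interp_class Γ a (s : tm R Γ a) : G (fclass s) = interp s.
Proof.
elim/tm_ind_all: Γ a / s => [a|Γ A b f ss /G_all IH
  |Γ A ss /G_all IH|Γ Θ δ γ δ' A b e e' s t IHs IHt].
- exact: G_id.
- by rewrite /= -IH -G_mor -G_subst /= hcomp_vars_l.
- by rewrite /= -IH -G_re -G_subst /= hcomp_vars_l.
have midE Ξ Θ' (g : Ξ = δ ++ Θ' ++ δ') (r : tm R Θ' (Ten A)) :
    hmap1 (fun _ _ t => G (fclass t))
      (hcat (vars δ) g (hcons erefl r (vars δ'))) = mid g (G (fclass r)).
  by rewrite hmap1_hcat /= !(hmap1_hids (id' := id)).
rewrite -[in LHS]subst_Let_var G_subst midE IHt /= /letm; congr comp.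
(* Putting the tuple of variables for the variable of type [Ten A] creates a beta redex that
   contracts to [s], so [G] must send the let of a variable to the preimage of [interp s]. *)
apply: unre_uniq; rewrite -G_re -midE -G_subst subst_Let_var -IHs.
congr G; apply/fclass_eq; apply: sim_trans (beta_Let _ _ _ _) _.
by rewrite -(vars3 e' e' (esym e')) subst_vars; apply: sim_refl.
Qed.

Lemma G_interp Γ a (f : free_hom Γ a) : G f = free_interp f.
Proof. by rewrite -[f in LHS]fclass_repr G_interp_class. Qed.
End Uniqueness.
End Interpretation.

(** * Families under a change of objects *)

Section HmapTheory.
Variables (O O' : Type) (f : O -> O').
Variables (H : seq O -> O -> Type) (H' : seq O' -> O' -> Type).
Variable F : forall Γ a, H Γ a -> H' (map f Γ) (f a).
Arguments F {Γ a}.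
Implicit Types (Γ Δ A B : seq O) (a : O).
Local Notation hmapF := (hmap (H := H) (H' := H') (@F)).

Lemma pack_hmap_hcat Γ Γ1 Γ2 A B (e : Γ = Γ1 ++ Γ2) (σ : homs H Γ1 A)
    (τ : homs H Γ2 B) :
  Pack (hmapF (hcat σ e τ)) = pcat (Pack (hmapF σ)) (Pack (hmapF τ)).
Proof.
elim: σ Γ e => [|X X1 X2 a A' e' g σ IH] Γ e.
  by subst Γ.
rewrite [LHS]pack_consE IH pcatA; congr (pcat _ _).
exact: (esym (pack_consE _ _ _)).
Qed.

Lemma hmap_hids (id : forall a, H [:: a] a) (id' : forall b, H' [:: b] b) A :
  (forall a, F (id a) = id' (f a)) -> hmapF (hids id A) = hids id' (map f A).
Proof. by move=> E; elim: A => //= a A ->; rewrite E; apply: hcons_irr. Qed.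

Lemma hmap_h1 Γ a (g : H Γ a) : hmapF (h1 g) = h1 (F g).
Proof. exact: hcons_irr. Qed.

Lemma hmap_hcomp (comp : forall Γ a Δ, H Γ a -> homs H Δ Γ -> H Δ a)
    (comp' : forall X b Y, H' X b -> homs H' Y X -> H' Y b) Γ A Δ
    (σ : homs H Γ A) (τ : homs H Δ Γ) :
  (forall Γ a Δ (g : H Γ a) (τ : homs H Δ Γ),
    F (comp _ _ _ g τ) = comp' _ _ _ (F g) (hmapF τ)) ->
  hmapF (hcomp comp σ τ) = hcomp comp' (hmapF σ) (hmapF τ).
Proof.
move=> E; elim: σ Δ τ => [|X X1 X2 a B e g σ IH] Δ τ.
  by case: (hnilP τ) => e ->; subst Δ.
subst X; case: (hcatP τ) => Δ1 [Δ2 [e [τ1 [τ2 ->]]]].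
have eΔ : map f Δ = map f Δ1 ++ map f Δ2 by rewrite e map_cat.
have -> : hmapF (hcat τ1 e τ2) =
    hcastr (esym (map_cat f X1 X2)) (hcat (hmapF τ1) eΔ (hmapF τ2)).
  by apply/esym/pack_inj; rewrite pack_hmap_hcat pack_hcat.
rewrite [hmapF (hcons _ _ _)]/= hcomp_hcons /= hsplit_hcat /= E IH.
exact: hcons_irr.
Qed.

Lemma hmap_hmap1 (H0 : seq O -> O -> Type) (G : forall Γ a, H0 Γ a -> H Γ a)
    Γ A (σ : homs H0 Γ A) :
  hmapF (hmap1 G σ) = hmap (fun Γ a x => F (G Γ a x)) σ.
Proof. by elim: σ => //= X X1 X2 a B e g σ ->. Qed.
End HmapTheory.

(** * Restriction of [S] along [i] and existence of the extension *)

Section Restriction.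
Variables (R : signature) (S : rep_multicategory) (i : sig_map R S).
Local Notation ty := (ty (atom R)).
Implicit Types (Γ Δ Θ γ δ A B : seq ty) (a b : ty).

Definition rhom Γ a : Type := @hom S (map i Γ) (i a).

(** The arrows stay the same; only the indexing lists pass from types to objects of [S]. *)
Definition rfam Γ A (σ : homs rhom Γ A) : homs (@hom S) (map i Γ) (map i A) :=
  hmap (H := rhom) (H' := @hom S) (f := i) (fun _ _ g => g) σ.

Definition rid a : rhom [:: a] a := idm (i a).

Definition rcomp Γ a Δ (f : rhom Γ a) (σ : homs rhom Δ Γ) : rhom Δ a :=
  Defs.comp (m := S) f (rfam σ).

Lemma rcomp_id1 Γ a (f : rhom Γ a) : rcomp f (hids rid Γ) = f.
Proof.
by rewrite /rcomp /rfam (hmap_hids (id' := @idm S)) // comp_id1.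
Qed.

Lemma rcomp_1id Γ a (g : rhom Γ a) : rcomp (rid a) (h1 g) = g.
Proof. by rewrite /rcomp /rfam hmap_h1 comp_1id. Qed.

Lemma rcomp_assoc Γ a Δ Θ (f : rhom Γ a) (σ : homs rhom Δ Γ)
  (τ : homs rhom Θ Δ) : rcomp (rcomp f σ) τ = rcomp f (hcomp rcomp σ τ).
Proof.
by rewrite /rcomp comp_assoc /rfam (hmap_hcomp (comp' := @Defs.comp S)).
Qed.

(** The transport along [iob_ten] is confined to this definition, and [arrow_rre] removes it. *)
Definition rre A : rhom A (Ten A) :=
  match esym (iob_ten i A) in _ = x return @hom S (map i A) x with
  | erefl => re (map i A)
  end.

Lemma arrow_rre A : Arrow (rre A : hom _ _) = Arrow (re (map i A)).
Proof. by rewrite /rre; case: _ / (esym (iob_ten i A)). Qed.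

Lemma rre_bij γ A δ a : bijective (fun f : rhom (γ ++ Ten A :: δ) a =>
  rcomp f (hat rid γ δ (rre A))).
Proof.
(* Bijectivity is stated for a packed family, so that it can be rewritten along an equation that
   changes source and target. *)
pose P (p : packed (@hom S)) := let: @Pack _ _ Γ A σ := p in
  forall b : ob S, bijective (fun f : @hom S A b => Defs.comp f σ).
suff: P (Pack (rfam (hat rid γ δ (rre A)))) by apply.
have -> : Pack (rfam (hat rid γ δ (rre A))) =
    Pack (hat (@idm S) (map i γ) (map i δ) (re (map i A))).
  rewrite /rfam pack_hmap_hcat pack_hcat.
  rewrite !(hmap_hids (id' := @idm S)) //; congr (pcat _ _).
  rewrite [LHS]pack_consE [RHS]pack_consE; congr (pcat _ _).
    by have /(congr1 (fun x : arrow S =>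
      let: Arrow _ _ g := x in Pack (h1 g))) := arrow_rre A.
  by congr Pack; apply: (hmap_hids (H := rhom) (f := i)).
by move=> b; apply: re_bij.
Qed.

Definition extension_hom Γ a : @hom (free R) Γ a -> rhom Γ a :=
  free_interp rre_bij (@imor R S i) (a := a).

Lemma extension_id a : extension_hom (@idm (free R) a) = idm (i a).
Proof. exact: (free_interpE rcomp_id1 rcomp_1id rcomp_assoc). Qed.

Lemma extension_comp Γ a Δ (f : @hom (free R) Γ a)
    (σ : homs (@hom (free R)) Δ Γ) :
  extension_hom (Defs.comp (m := free R) f σ) =
  Defs.comp (m := S) (extension_hom f) (hmap extension_hom σ).
Proof.
(* Mapping over a family splits into the interpretation followed by [rfam], the form in which
   [rcomp] composes. *)
rewrite -(hmap_hmap1 (H := rhom) (H' := @hom S) (f := i) (fun _ _ g => g)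
  extension_hom).
exact: (free_interp_comp rcomp_id1 rcomp_1id rcomp_assoc).
Qed.

Lemma extension_class Γ a (s : tm R Γ a) :
  extension_hom (fclass s) = interp rre_bij (@imor R S i) s.
Proof. exact: (free_interpE rcomp_id1 rcomp_1id rcomp_assoc). Qed.

Lemma extension_re A :
  Arrow (extension_hom (re (r := free R) A)) = Arrow (re (map i A)).
Proof.
by rewrite -arrow_rre extension_class /= hmap1_vars rcomp_id1.
Qed.

Lemma extension_marrow A b (f : marrow R A b) :
  extension_hom (free_marrow f) = imor i f.
Proof. by rewrite extension_class /= hmap1_vars rcomp_id1. Qed.

Definition extension : rep_functor (free R) S :=
  @RepFunctor (free R) S (iob i) extension_hom extension_id extension_comp
    (iob_ten i) extension_re.
End Restriction.

(** * Uniqueness of the extension *)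

Lemma arrow_inj (S : multicategory) (Γ : seq (ob S)) (a : ob S)
    (f g : hom Γ a) : Arrow f = Arrow g -> f = g.
Proof.
(* Equality of arrows gives equality up to transport along any identification of the indices; by
   proof irrelevance these transports are trivial. *)
move=> E; pose P (x : arrow S) := let: Arrow Δ b h := x in
  forall (e1 : Γ = Δ) (e2 : a = b),
  match e1 in _ = X, e2 in _ = y return hom X y with erefl, erefl => f end = h.
have: P (Arrow g).
  rewrite -E => e1 e2.
  by rewrite (Prop_irrelevance e1 erefl) (Prop_irrelevance e2 erefl).
exact: (fun h => h erefl erefl).
Qed.

Lemma extension_unique (R : signature) (S : rep_multicategory)
    (i : sig_map R S) (F : rep_functor (free R) S) :
  (forall a, F a = i a) ->
  (forall A b (f : marrow R A b),
    Arrow (fhom F (free_marrow f)) = Arrow (imor i f)) ->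
  extension i = F.
Proof.
(* Once the object maps are identified by function extensionality, the two maps on arrows have the
   same type. *)
case: F => Fo Fh Fid Fcomp Ften Fre /= /funext E; subst Fo => Fmor.
have FhE : Fh = extension_hom i.
  apply: functional_extensionality_dep => Γ.
  apply: functional_extensionality_dep => a; apply: funext => f.
  apply: (G_interp (@rre_bij R S i) (G := Fh)).
  - exact: Fid.
  - move=> X b Y g σ; rewrite /rcomp /rfam hmap_hmap1; exact: Fcomp.
  - by move=> A; apply: arrow_inj; rewrite arrow_rre; apply: Fre.
  - by move=> A b g; apply: arrow_inj; apply: Fmor.
(* The remaining fields are proofs. *)
subst Fh; congr RepFunctor; exact: Prop_irrelevance.
Qed.

Theorem theorem3p15 (R : signature) (S : rep_multicategory) (i : sig_map R S) :
  exists! F : rep_functor (free R) S,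
    (forall a : ty (atom R), F a = i a) /\
    (forall A b (f : marrow R A b),
       Arrow (fhom F (free_marrow f)) = Arrow (imor i f)).
Proof.
exists (extension i); split.
  by split=> // A b f; congr Arrow; apply: extension_marrow.
by move=> F [Fob Fmor]; apply: extension_unique.
Qed.
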